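(* Let $d\ge1$ and let $\mathcal{F}=\{f_i : 1\le i\le k\}$ be a self-similar iterated function system in $\mathbf{C}^d$ satisfying the open set condition, and let $\widetilde{\mathcal{F}}=\{\widetilde f_i : 1\le i\le k\}$ be a lift of $\mathcal{F}$ to the Heisenberg group $\mathcal{H}^d$. Let $X\subset\mathbf{C}^d$ be the attractor of $\mathcal{F}$ and $\widetilde X\subset\mathcal{H}^d$ the attractor of $\widetilde{\mathcal{F}}$. Then for every $x\in\mathcal{H}^d$, the dimension of $\widetilde X$ transverse to the foliation by chains passing through $x$ is equal to $\dim(X)=\dim(\widetilde X)$; that is, $$\dim\big(\pi_x(\widetilde X\setminus\{x\})\big)=\dim(X)=\dim(\widetilde X).$$
   Context: $\dim$ is Hausdorff dimension, with respect to the Euclidean metric in $\mathbf{C}^d$ and in the target of $\pi_x$, and with respect to the Korányi metric in $\mathcal{H}^d$. Heisenberg group. $\mathcal{H}^d=\mathbf{C}^d\times\mathbf{R}$ with $(u,s)\cdot(v,t)=(u+v,s+t-\omega(u,v))$, $\omega(u,v)=\mathrm{Im}(u\cdot v)$, $u\cdot v=\sum_k\overline{u_k}v_k$. Center $Z=\{0\}\times\mathbf{R}$; $\pi_Z:\mathcal{H}^d\to\mathcal{H}^d/Z\simeq\mathbf{C}^d$, $(u,s)\mapsto u$. Korányi gauge $\|(u,s)\|=(\|u\|^4+4s^2)^{1/4}$ and metric $d(h_1,h_2)=\|h_1^{-1}\cdot h_2\|$. Dilations: $r\cdot(u,s)=(ru,r^2s)$, $r>0$. Iterated function systems. A contractive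 Heisenberg similarity is a map $\widetilde f=\tau\circ h\circ \rho$ with $\rho(u,s)=(Uu,s)$, $U\in\mathbf{U}(d)$, $h$ the dilation of some ratio $r\in(0,1)$, and $\tau$ a left translation of $\mathcal{H}^d$. It induces on $\mathbf{C}^d$ the contractive similarity $f$ characterized by $\pi_Z\circ\widetilde f=f\circ\pi_Z$; $\widetilde f$ is then called a lift of $f$. $\widetilde{\mathcal{F}}$ is a lift of $\mathcal{F}$ if each $\widetilde f_i$ is a lift of $f_i$. The attractor of a finite family $\{g_i\}$ of contractions is the unique nonempty compact set $K$ with $K=\bigcup_i g_i(K)$. $\mathcal{F}$ satisfies the open set condition if there is a nonempty open $U\subset\mathbf{C}^d$ such that the sets $f_i(U)$ are pairwise disjoint and contained in $U$. Chains and radial projections. On $\mathbf{C}^{d+2}$ (coordinates $x_0,\dots,x_{d+1}$) let $\langle x,y\rangle=\overline{x_0}y_{d+1}+\overline{x_{d+1}}y_0-\sum_{k=1}^d\overline{x_k}y_k$; in the projective space $\mathbf{P}_{\mathbf{C}}^{d+1}$ let $\mathbf{H}_{\mathbf{C}}^{d+1}=\{[x]:\langle x,x\rangle>0\}$, $\partial\mathbf{H}_{\mathbf{C}}^{d+1}=\{[x]:\langle x,x\rangle=0\}$, and let $f_0=(1,0,\dots,0)$. The map $\Phi(u,s)=\big[\tfrac{\|u\|^2}{2}+is:\overline{u_1}:\dots:\overline{u_d}:1\big]$ is a bijection $\mathcal{H}^d\to\partial\mathbf{H}_{\mathbf{C}}^{d+1}\setminus\{[f_0]\}$. Chains in $\mathcal{H}^d$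 are the preimages under $\Phi$ of the sets $L\cap\partial\mathbf{H}_{\mathbf{C}}^{d+1}$, $L$ a complex projective line meeting $\mathbf{H}_{\mathbf{C}}^{d+1}$; through two distinct points of $\mathcal{H}^d$ passes a unique chain. For $x\ne0$ in $\mathbf{C}^{d+2}$ let $x^\dagger$ be the orthogonal of $\mathbf{C}x$ for $\langle\cdot,\cdot\rangle$. For $[x]\in\partial\mathbf{H}_{\mathbf{C}}^{d+1}$ let $\Lambda^d(x^\dagger)$ be the space of $d$-vectors of $x^\dagger$ with the inner product (linear in the second variable) induced from the standard one of $\mathbf{C}^{d+2}$, $\mathcal{A}([x])=\{\mathbf{u}\in\Lambda^d(x^\dagger):x\vee\mathbf{u}=0\}\simeq\mathbf{C}^d$ ($\vee$ the exterior product), and $\hat{\mathbf{x}}$ a unit vector of $\Lambda^d(x^\dagger)$ orthogonal to $\mathcal{A}([x])$. For $h\in\mathcal{H}^d$ with $\Phi(h)=[x]$ define $$\pi_h:\mathcal{H}^d\setminus\{h\}\to\mathcal{A}(\Phi(h)),\qquad \pi_h(h')=\frac{\mathbf{u}}{\hat{\mathbf{x}}\cdot\mathbf{u}}-\hat{\mathbf{x}},$$ where $\mathbf{u}=v_1\vee\dots\vee v_d$ for any basis $(v_1,\dots,v_d)$ of $x^\dagger\cap y^\dagger$, $[y]=\Phi(h')$. It is locally Lipschitz and its fibres are the chains through $h$ (with $h$ removed). The dimension of a Borel set $A$ transverse to the foliation by chains through $h$ is the Hausdorff dimension of $\pi_h(A\setminus\{h\})$. *)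

(* Defs.v *)
(* The field of complex numbers is R[i], for an arbitrary R : realType. *)
From HB Require Import structures.
From mathcomp Require Import all_boot all_order all_algebra.
From mathcomp Require Import spectral ring.
From mathcomp Require Import complex.
From mathcomp Require Import all_classical all_reals.
From mathcomp Require Import ereal topology sequences exp.

Set Implicit Arguments.
Unset Strict Implicit.
Unset Printing Implicit Defensive.

Import Order.TTheory GRing.Theory Num.Theory.
Local Open Scope classical_set_scope.
Local Open Scope ring_scope.

Section Hermitian.
Variables (R : realType) (I : finType).
Implicit Types u v w : I -> R[i].

(* Conjugate-linear in the first variable. *)
Definition hdot u v : R[i] := \sum_i (u i)^*%C * v i.

Definition hnorm u : R := Num.sqrt (\sum_i Normc.normc (u i) ^+ 2).

Definition hdist u v : R := hnorm (fun i => u i - v i).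

Let nc (z : R[i]) : R := Normc.normc z.

Lemma normc_ge0 (z : R[i]) : 0 <= nc z.
Proof. by case: z => a b /=; rewrite sqrtr_ge0. Qed.

Lemma hnorm_ge0 u : 0 <= hnorm u.
Proof. exact: sqrtr_ge0. Qed.

Lemma hnorm_sqr u : hnorm u ^+ 2 = \sum_i nc (u i) ^+ 2.
Proof. by rewrite sqr_sqrtr// sumr_ge0// => i _; rewrite sqr_ge0. Qed.

Lemma eq_hnorm u v : u =1 v -> hnorm u = hnorm v.
Proof. by move=> uv; congr Num.sqrt; apply: eq_bigr => i _; rewrite uv. Qed.

Lemma hnormN u : hnorm (fun i => - u i) = hnorm u.
Proof. by congr Num.sqrt; apply: eq_bigr => i _; rewrite normcN. Qed.

Lemma hnorm_eq0 u : hnorm u = 0 -> forall i, u i = 0.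
Proof.
move=> /(congr1 (fun x => x ^+ 2)); rewrite hnorm_sqr expr0n/= => /eqP.
rewrite psumr_eq0; last by move=> i _; rewrite sqr_ge0.
move=> /allP u0 i; have := u0 i (mem_index_enum _) => /=.
by rewrite sqrf_eq0 => /eqP/Normc.eq0_normc.
Qed.

Lemma hnorm0 : hnorm (fun=> 0) = 0.
Proof.
rewrite /hnorm big1 ?sqrtr0// => i _.
by rewrite Normc.normc0 expr0n.
Qed.

Lemma real_CauchySchwarz (a b : I -> R) :
  (\sum_i a i * b i) ^+ 2 <= (\sum_i a i ^+ 2) * (\sum_i b i ^+ 2).
Proof.
set S := \sum_i a i * b i; set A := \sum_i a i ^+ 2; set B := \sum_i b i ^+ 2.
have B0 : 0 <= B by apply: sumr_ge0 => i _; rewrite sqr_ge0.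
have H : B * (A * B - S ^+ 2) = \sum_i (B * a i - S * b i) ^+ 2.
  rewrite (eq_bigr (fun i => B ^+ 2 * a i ^+ 2 + (- (2 * B * S) * (a i * b i)
    + S ^+ 2 * b i ^+ 2))); last by move=> i _; ring.
  by rewrite !big_split/= -!mulr_sumr -/S -/A -/B; ring.
have P : 0 <= B * (A * B - S ^+ 2).
  by rewrite H sumr_ge0// => i _; rewrite sqr_ge0.
have [Bp|] := ltP 0 B; first by move: P; rewrite pmulr_rge0// subr_ge0.
move=> Bn; have Be : B = 0 by apply/eqP; rewrite eq_le Bn B0.
have b0 i : b i = 0.
  move/eqP: Be; rewrite psumr_eq0; last by move=> j _; rewrite sqr_ge0.
  by move=> /allP/(_ i (mem_index_enum _)) /=; rewrite sqrf_eq0 => /eqP.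
by rewrite /S big1 ?expr0n/= ?Be ?mulr0// => i _; rewrite b0 mulr0.
Qed.

Lemma normc_sum (F : I -> R[i]) : nc (\sum_i F i) <= \sum_i nc (F i).
Proof.
elim/big_ind2: _ => [|x1 x2 y1 y2 h1 h2|//]; first by rewrite /nc Normc.normc0.
by rewrite (le_trans (le_normcD _ _))// lerD.
Qed.

Lemma normc_conj (z : R[i]) : nc (z^*)%C = nc z.
Proof. by case: z => a b; rewrite /nc /= sqrrN. Qed.

Lemma sum_normc_le u v : \sum_i nc (u i) * nc (v i) <= hnorm u * hnorm v.
Proof.
rewrite -[leRHS]ger0_norm ?mulr_ge0 ?hnorm_ge0// -sqrtr_sqr exprMn !hnorm_sqr.
by rewrite (le_trans (ler_norm _))// -sqrtr_sqr ler_wsqrtr// real_CauchySchwarz.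
Qed.

Lemma hdot_le u v : nc (hdot u v) <= hnorm u * hnorm v.
Proof.
apply: le_trans (sum_normc_le u v); apply: le_trans (normc_sum _) _.
by apply: ler_sum => i _; rewrite /nc Normc.normcM -/(nc _) normc_conj.
Qed.

Lemma hnormD u v : hnorm (fun i => u i + v i) <= hnorm u + hnorm v.
Proof.
rewrite -[leRHS]ger0_norm ?addr_ge0 ?hnorm_ge0// -sqrtr_sqr ler_wsqrtr//.
rewrite sqrrD !hnorm_sqr.
apply: (@le_trans _ _ (\sum_i (nc (u i) + nc (v i)) ^+ 2)).
  apply: ler_sum => i _; rewrite ler_sqr ?nnegrE ?addr_ge0 ?normc_ge0//.
  exact: le_normcD.
under eq_bigr do rewrite sqrrD.
rewrite 2!big_split/= lerD2r lerD2l sumrMnl lerMn2r/=.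
exact: sum_normc_le.
Qed.

Lemma hdistxx u : hdist u u = 0.
Proof. by rewrite -hnorm0; apply: eq_hnorm => i; rewrite subrr. Qed.

Lemma hdist_eq0 u v : hdist u v = 0 -> u =1 v.
Proof. by move=> /hnorm_eq0 uv i; apply/eqP; rewrite -subr_eq0 uv. Qed.

Lemma hdist_sym u v : hdist u v = hdist v u.
Proof. by rewrite -[LHS]hnormN; apply: eq_hnorm => i; rewrite opprB. Qed.

Lemma hdist_triangle v u w : hdist u w <= hdist u v + hdist v w.
Proof.
apply: le_trans (hnormD _ _); rewrite le_eqVlt; apply/orP; left; apply/eqP.
by apply: eq_hnorm => i; rewrite subrKA.
Qed.

End Hermitian.

(* An alias, so that the metric structure is the Euclidean one and not the sup
   metric that the library puts on matrices. *)
Definition cspace (R : realType) (d : nat) : Type := 'rV[R[i]]_d.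

HB.instance Definition _ (R : realType) d :=
  GRing.Lmodule.copy (cspace R d) 'rV[R[i]]_d.

Section CspaceMetric.
Variables (R : realType) (d : nat).

Definition ccoord (u : cspace R d) : 'I_d -> R[i] :=
  fun k => (u : 'rV[R[i]]_d) ord0 k.

Definition cspace_dist (u v : cspace R d) : R := hdist (ccoord u) (ccoord v).

Let cspace_distxx u : cspace_dist u u = 0.
Proof. exact: hdistxx. Qed.

Let cspace_dist_pos u v : cspace_dist u v = 0 -> u = v.
Proof. by move=> /hdist_eq0 uv; apply/rowP. Qed.

Let cspace_dist_sym u v : cspace_dist u v = cspace_dist v u.
Proof. exact: hdist_sym. Qed.

Let cspace_dist_tri v u w :
  cspace_dist u w <= cspace_dist u v + cspace_dist v w.
Proof. exact: hdist_triangle. Qed.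

HB.instance Definition _ := @isMetric.Build R (cspace R d) cspace_dist
  cspace_distxx cspace_dist_pos cspace_dist_sym cspace_dist_tri.

End CspaceMetric.

Record heis (R : realType) (d : nat) := Heis { hvec : cspace R d ; hht : R }.
Arguments Heis {R d}.

Section Heisenberg.
Variables (R : realType) (d : nat).
Local Notation H := (heis R d).
Implicit Types (u v w : cspace R d) (a g h : H).

Let heis_pair h : cspace R d * R := (hvec h, hht h).
Let pair_heis (p : cspace R d * R) : H := Heis p.1 p.2.
Let heis_pairK : cancel heis_pair pair_heis. Proof. by case. Qed.

HB.instance Definition _ := Choice.copy H (can_type heis_pairK).

Definition cdot u v : R[i] := hdot (ccoord u) (ccoord v).
Definition cnorm u : R := hnorm (ccoord u).
Definition omega u v : R := complex.Im (cdot u v).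

Definition heis_one : H := Heis 0 0.
Definition heis_mul g h : H :=
  Heis (hvec g + hvec h) (hht g + hht h - omega (hvec g) (hvec h)).
Definition heis_inv g : H := Heis (- hvec g) (- hht g).

Let ccoordD u v i : ccoord (u + v) i = ccoord u i + ccoord v i.
Proof. by rewrite /ccoord mxE. Qed.

Let ccoordN u i : ccoord (- u) i = - ccoord u i.
Proof. by rewrite /ccoord mxE. Qed.

Let cdotDl u v w : cdot (u + v) w = cdot u w + cdot v w.
Proof.
by rewrite -big_split; apply: eq_bigr => i _; rewrite ccoordD rmorphD mulrDl.
Qed.

Let cdotDr u v w : cdot w (u + v) = cdot w u + cdot w v.
Proof.
by rewrite -big_split; apply: eq_bigr => i _; rewrite ccoordD mulrDr.
Qed.

Let cdotNl u v : cdot (- u) v = - cdot u v.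
Proof.
by rewrite -sumrN; apply: eq_bigr => i _; rewrite ccoordN rmorphN mulNr.
Qed.

Let cdotNr u v : cdot u (- v) = - cdot u v.
Proof.
by rewrite -sumrN; apply: eq_bigr => i _; rewrite ccoordN mulrN.
Qed.

Let cdotxx u : cdot u u = ((cnorm u ^+ 2)%:C)%C.
Proof.
rewrite /cnorm hnorm_sqr rmorph_sum/=; apply: eq_bigr => i _.
case: (ccoord u i) => a b; rewrite /= sqr_sqrtr ?addr_ge0 ?sqr_ge0//.
apply/eqP; rewrite eq_complex/=; apply/andP; split; apply/eqP; ring.
Qed.

Let cdotC u v : cdot u v = ((cdot v u)^*)%C.
Proof.
rewrite /cdot /hdot rmorph_sum/=; apply: eq_bigr => i _.
by rewrite rmorphM/= conjcK mulrC.
Qed.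

Let ImD (x y : R[i]) : complex.Im (x + y) = complex.Im x + complex.Im y.
Proof. by case: x => a b; case: y. Qed.
Let ImN (x : R[i]) : complex.Im (- x) = - complex.Im x.
Proof. by case: x. Qed.

Let omegaDl u v w : omega (u + v) w = omega u w + omega v w.
Proof. by rewrite /omega cdotDl ImD. Qed.
Let omegaDr u v w : omega w (u + v) = omega w u + omega w v.
Proof. by rewrite /omega cdotDr ImD. Qed.
Let omegaNl u v : omega (- u) v = - omega u v.
Proof. by rewrite /omega cdotNl ImN. Qed.
Let omegaNr u v : omega u (- v) = - omega u v.
Proof. by rewrite /omega cdotNr ImN. Qed.
Let omegaxx u : omega u u = 0.
Proof. by rewrite /omega cdotxx. Qed.
Let omega0l u : omega 0 u = 0.
Proof. by apply: (addrI (omega 0 u)); rewrite -omegaDl !addr0. Qed.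
Let omega0r u : omega u 0 = 0.
Proof. by apply: (addrI (omega u 0)); rewrite -omegaDr !addr0. Qed.

Let heis_eq g h : hvec g = hvec h -> hht g = hht h -> g = h.
Proof. by case: g => u s; case: h => v t /= -> ->. Qed.

Let heis_mulA : associative heis_mul.
Proof.
move=> g h k; apply: heis_eq; rewrite /= ?addrA// omegaDl omegaDr; ring.
Qed.

Let heis_mul1g : left_id heis_one heis_mul.
Proof. by move=> g; apply: heis_eq; rewrite /= ?omega0l ?add0r ?subr0. Qed.

Let heis_mulg1 : right_id heis_one heis_mul.
Proof. by move=> g; apply: heis_eq; rewrite /= ?omega0r ?addr0 ?subr0. Qed.

Let heis_mulVg : left_inverse heis_one heis_inv heis_mul.
Proof.
by move=> g; apply: heis_eq; rewrite /= addNr// omegaNl omegaxx oppr0 subr0.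
Qed.

Let heis_mulgV : right_inverse heis_one heis_inv heis_mul.
Proof.
by move=> g; apply: heis_eq; rewrite /= addrN// omegaNr omegaxx oppr0 subr0.
Qed.

HB.instance Definition _ := isGroup.Build H
  heis_mulA heis_mul1g heis_mulg1 heis_mulVg heis_mulgV.

Definition koranyi_gauge g : R :=
  Num.sqrt (Num.sqrt (cnorm (hvec g) ^+ 4 + 4 * hht g ^+ 2)).

Definition koranyi_dist g h : R := koranyi_gauge (g^-1 * h)%g.

Let cnorm_ge0 u : 0 <= cnorm u. Proof. exact: hnorm_ge0. Qed.

Let cnormN u : cnorm (- u) = cnorm u.
Proof.
by rewrite -[RHS]hnormN; apply: eq_hnorm => i; rewrite ccoordN.
Qed.

Let gauge_ge0 g : 0 <= koranyi_gauge g. Proof. exact: sqrtr_ge0. Qed.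

(* gauge^2 is the modulus of |u|^2 + 2is *)
Let gaugeC g : R[i] := ((cnorm (hvec g) ^+ 2) +i* (2 * hht g))%C.

Let gauge_sqr g : koranyi_gauge g ^+ 2 = Normc.normc (gaugeC g).
Proof.
rewrite sqr_sqrtr ?sqrtr_ge0//=; congr Num.sqrt.
by rewrite /=; ring.
Qed.

Let cnorm_le_gauge g : cnorm (hvec g) <= koranyi_gauge g.
Proof.
rewrite -ler_sqr ?nnegrE// [leRHS]sqr_sqrtr ?sqrtr_ge0//.
have <- : Num.sqrt ((cnorm (hvec g) ^+ 2) ^+ 2) = cnorm (hvec g) ^+ 2.
  by rewrite sqrtr_sqr ger0_norm// sqr_ge0.
by rewrite ler_wsqrtr// -exprM lerDl mulr_ge0// sqr_ge0.
Qed.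

Let gaugeCM g h : gaugeC (g * h)%g =
  gaugeC g + gaugeC h + ((cdot (hvec g) (hvec h))^*)%C *+ 2.
Proof.
have /(congr1 (@complex.Re R)) := cdotxx (hvec g + hvec h).
rewrite cdotDl !cdotDr !cdotxx (cdotC (hvec h) (hvec g)) /gaugeC/=.
rewrite /omega; case: (cdot _ _) => a b /= <-.
by apply/eqP; rewrite eq_complex/=; apply/andP; split; apply/eqP; ring.
Qed.

Let gaugeM g h :
  koranyi_gauge (g * h)%g <= koranyi_gauge g + koranyi_gauge h.
Proof.
rewrite -ler_sqr ?nnegrE ?addr_ge0// gauge_sqr gaugeCM.
rewrite (le_trans (le_normcD _ _))// sqrrD addrAC lerD//.
  by rewrite (le_trans (le_normcD _ _))// !gauge_sqr.
rewrite normcMn lerMn2r/= normc_conj (le_trans (hdot_le _ _))//.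
by rewrite ler_pM ?cnorm_le_gauge// hnorm_ge0.
Qed.

Let gaugeV g : koranyi_gauge (g^-1)%g = koranyi_gauge g.
Proof. by rewrite /koranyi_gauge/= cnormN sqrrN. Qed.

Let gauge1 : koranyi_gauge 1%g = 0.
Proof.
rewrite /koranyi_gauge /= /cnorm (_ : hnorm _ = 0).
  by rewrite !expr0n/= mulr0 addr0 !sqrtr0.
by rewrite -(@hnorm0 R 'I_d); apply: eq_hnorm => i; rewrite /ccoord mxE.
Qed.

Let gauge_eq0 g : koranyi_gauge g = 0 -> g = 1%g.
Proof.
move=> g0; have /Normc.eq0_normc/eqP : Normc.normc (gaugeC g) = 0.
  by rewrite -gauge_sqr g0 expr0n.
rewrite eq_complex/= => /andP[].
rewrite sqrf_eq0 mulf_eq0 pnatr_eq0/= => /eqP/hnorm_eq0 u0 /eqP s0.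
by apply: heis_eq => //; apply/rowP => i; rewrite [LHS]u0 mxE.
Qed.

Let koranyi_distxx g : koranyi_dist g g = 0.
Proof. by rewrite /koranyi_dist mulVg. Qed.

Let koranyi_dist_pos g h : koranyi_dist g h = 0 -> g = h.
Proof. by move=> /gauge_eq0/(congr1 (fun x => g * x)%g); rewrite mulVKg mulg1. Qed.

Let koranyi_dist_sym g h : koranyi_dist g h = koranyi_dist h g.
Proof. by rewrite /koranyi_dist -gaugeV invgM invgK. Qed.

Let koranyi_dist_tri h g k :
  koranyi_dist g k <= koranyi_dist g h + koranyi_dist h k.
Proof.
by apply: le_trans (gaugeM _ _); rewrite -mulgA mulVKg.
Qed.

HB.instance Definition _ := @isMetric.Build R H koranyi_dist
  koranyi_distxx koranyi_dist_pos koranyi_dist_sym koranyi_dist_tri.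

Definition left_translation a g : H := (a * g)%g.

Definition dilation (r : R) g : H :=
  Heis ((r%:C)%C *: hvec g) (r ^+ 2 * hht g).

(* Elements of C^d are row vectors: this is the transpose of U u. *)
Definition unitary_rotation (U : 'M[R[i]]_d) g : H :=
  Heis ((hvec g : 'rV_d) *m U^T) (hht g).

Definition heis_contractive_similarity (ft : H -> H) : Prop :=
  exists (a : H) (r : R) (U : 'M[R[i]]_d),
    [/\ 0 < r < 1, U \is unitarymx &
        ft = left_translation a \o dilation r \o unitary_rotation U].

Definition is_lift (ft : H -> H) (f : cspace R d -> cspace R d) : Prop :=
  heis_contractive_similarity ft /\ (@hvec R d) \o ft = f \o (@hvec R d).

End Heisenberg.

Section IFS.
Variables (R : realType).

Definition contractive_similarity (T : metricType R) (f : T -> T) : Prop :=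
  exists2 r : R, 0 < r < 1 & forall x y, mdist (f x) (f y) = r * mdist x y.

Definition open_set_condition (T : topologicalType) (k : nat)
    (f : 'I_k -> T -> T) : Prop :=
  exists U : set T, [/\ U !=set0, open U, forall i, f i @` U `<=` U &
    forall i j, i != j -> f i @` U `&` f j @` U = set0].

Definition is_attractor (T : topologicalType) (k : nat)
    (g : 'I_k -> T -> T) (K : set T) : Prop :=
  [/\ K !=set0, compact K & K = \bigcup_i (g i @` K)].

End IFS.

Section Hausdorff.
Variables (R : realType) (T : metricType R).
Local Open Scope ereal_scope.
Implicit Types (A U : set T) (s delta : R).

(* -oo for the empty set *)
Definition diameter U : \bar R :=
  ereal_sup [set (mdist x y)%:E | x in U & y in U].

(* For s = 0 every nonempty set has weight 1. *)
Definition diameter_pow s U : \bar R :=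
  if `[< U = set0 >] then 0 else poweR (diameter U) s.

Definition hausdorff_premeasure s delta A : \bar R :=
  ereal_inf [set \sum_(0 <= n <oo) diameter_pow s (V n) |
    V in [set V : nat -> set T | A `<=` \bigcup_n V n /\
                                 forall n, diameter (V n) <= delta%:E]].

Definition hausdorff_measure s A : \bar R :=
  ereal_sup [set hausdorff_premeasure s delta A |
    delta in [set delta : R | (0 < delta)%R]].

Definition hausdorff_dim A : \bar R :=
  ereal_inf [set s%:E | s in [set s : R | (0 <= s)%R /\
                                         hausdorff_measure s A = 0]].

End Hausdorff.

(* The family (u J) stands for \sum_J u J *: e_J, where e_J is the exterior
   product of the e_j, j in J, in increasing order. *)
Definition extalg (R : realType) (n : nat) : Type := {ffun {set 'I_n} -> R[i]}.

HB.instance Definition _ (R : realType) n :=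
  GRing.Lmodule.copy (extalg R n) {ffun {set 'I_n} -> R[i]}.

Section Exterior.
Variables (R : realType) (n : nat).
Local Notation E := (extalg R n).
Implicit Types (x : 'rV[R[i]]_n) (u v : E) (W : set 'rV[R[i]]_n).

Definition ecoord u : {set 'I_n} -> R[i] :=
  u : {ffun {set 'I_n} -> R[i]}.

Definition edist u v : R := hdist (ecoord u) (ecoord v).

Let edistxx u : edist u u = 0.
Proof. exact: hdistxx. Qed.

Let edist_pos u v : edist u v = 0 -> u = v.
Proof. by move=> /hdist_eq0 uv; apply/ffunP. Qed.

Let edist_sym u v : edist u v = edist v u.
Proof. exact: hdist_sym. Qed.

Let edist_tri v u w : edist u w <= edist u v + edist v w.
Proof. exact: hdist_triangle. Qed.

HB.instance Definition _ := @isMetric.Build R E edist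
  edistxx edist_pos edist_sym edist_tri.

(* The inner product for which the e_J form an orthonormal basis. *)
Definition edot u v : R[i] := hdot (ecoord u) (ecoord v).

Definition ext1 : E := [ffun J : {set 'I_n} => (J == finset.set0)%:R].

(* Left exterior product by a vector: e_j \/ e_I is zero if j is in I, and
   otherwise e_(j |: I) up to the sign of the number of i in I with i < j. *)
Definition vee x u : E :=
  [ffun J : {set 'I_n} => \sum_(j in J)
    (-1) ^+ #|[pred i in J | (i < j)%N]| * x ord0 j * ecoord u (J :\ j)%SET].

(* Exterior product of the rows of V, in order. *)
Definition vees p (V : 'M[R[i]]_(p, n)) : E :=
  foldr vee ext1 [seq row i V | i <- enum 'I_p].

(* p-vectors of a subspace W of C^n, as a subset of those of C^n. *)
Definition multivectors p W : set E :=
  [set u | exists m (c : 'I_m -> R[i]) (V : 'I_m -> 'M[R[i]]_(p, n)),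
    (forall k i, W (row i (V k))) /\ u = \sum_(k < m) c k *: vees (V k)].

Definition row_basis_of p W (V : 'M[R[i]]_(p, n)) : Prop :=
  row_free V /\ forall z, W z <-> (z <= V)%MS.

End Exterior.

Section RadialProjection.
Variables (R : realType) (d : nat).
Local Notation vec := 'rV[R[i]]_(d.+2).
Local Notation E := (extalg R d.+2).
Implicit Types (x y : vec) (u v : E) (h : heis R d).

Definition lorentz x y : R[i] :=
  (x ord0 ord0)^*%C * y ord0 ord_max + (x ord0 ord_max)^*%C * y ord0 ord0
  - \sum_(k < d.+2 | (0 < k <= d)%N) (x ord0 k)^*%C * y ord0 k.

Definition dagger x : set vec := [set z | lorentz x z = 0].

(* Homogeneous coordinates of the boundary point attached to h; coordinate k+1
   for k < d is the conjugate of the k-th coordinate of hvec h. *)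
Definition Phi h : vec :=
  \row_(j < d.+2)
    match unlift ord0 j with
    | None => ((cnorm (hvec h) ^+ 2 / 2) +i* hht h)%C
    | Some j1 => match unlift ord_max j1 with
                 | None => 1
                 | Some k => (ccoord (hvec h) k)^*%C
                 end
    end.

Definition calA x : set E :=
  [set u | multivectors d (dagger x) u /\ vee x u = 0].

(* Such a v is unique up to a unit complex factor. *)
Definition unit_normal x v : Prop :=
  [/\ multivectors d (dagger x) v, edot v v = 1 &
      forall u, calA x u -> edot u v = 0].

(* Changing the basis V multiplies u by its (nonzero) determinant, which does
   not affect the value; the value at h' = h is irrelevant. *)
Definition radial_proj h (xhat : E) (h' : heis R d) : E :=
  let V := xget 0 [set V : 'M[R[i]]_(d, d.+2) |
                    row_basis_of (dagger (Phi h) `&` dagger (Phi h')) V] in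
  let u := vees V in
  (edot xhat u)^-1 *: u - xhat.

Definition transverse_dim h (xhat : E) (A : set (heis R d)) : \bar R :=
  hausdorff_dim (radial_proj h xhat @` (A `\ h)).

End RadialProjection.

(* Main.v *)
Require Import Defs.
From mathcomp Require Import all_boot all_order all_algebra.
From mathcomp Require Import spectral complex zify ring lra.
From mathcomp Require Import all_classical all_reals.
From mathcomp Require Import ereal topology sequences esum exp normedtype.

(** Let r_i be the common ratio of f_i and of its lift, and let
    P(t) = sum_i r_i ^ t be the pressure, a strictly decreasing function.
    Each of the three dimensions is the infimum of the t >= 0 with P(t) < 1:
    it suffices that the t-dimensional measure of the set vanishes when
    P(t) < 1 and does not when P(t) > 1 ([hausdorff_dim_pressure]).  This
    bypasses the exponent s with P(s) = 1.

    Vanishing.  The cylinders of generation n of an attractor have total weight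
    of order P(t) ^ n ([attractor_null]).  The radial projection from h is
    Lipschitz on the part of the lifted attractor at distance at least 1/n from
    h, and countably many such parts exhaust it ([transverse_null]).

    Non-vanishing.  When P(t) > 1, the open set condition provides, among the
    words of some length, m words of the same ratio rho such that
    m * rho ^ t >= 2 and whose cylinders are at positive mutual distance once
    projected to C^d ([osc_separated_words]).  The infinite sequences of such
    words code points of the lifted attractor whose horizontal distance is at
    least c * rho ^ n when the codes first differ at place n
    ([separated_coding]).  A set that contains a family of points with this
    property has positive measure, because a cover of it by small sets is a
    cover of the space of codes by cylinders, of total mass at least 1
    ([avoid_cylinders], [separated_coding_hausdorff]).  This applies to the
    attractor in C^d and, the projection being 1-Lipschitz, to the lifted one.

    Transverse dimension.  The point is that at small scales the chains through
    h look vertical, so that the radial projection separates points as well as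
    the projection to C^d does.  Up to a left translation and an injective
    affine map, the radial projection from h is the chart
    (u, s) |-> u / (|u|^2 / 2 - i s) ([radial_proj_bilipschitz]): if x is the
    vector of h, the subspaces that are intersected have a basis b_k + F_k x,
    where F is the value of the chart and the b_k depend on h only, and the
    exterior product of this basis is affine in F since x is wedged at most
    once.  The differential of the chart along a horizontal vector v has norm
    |v| / |q|, where q = |u|^2 / 2 - i s, and the rest of the increment is
    bounded by the square of the distance ([chart_dist]).  Two coded points
    with codes that first differ at place n, moved inside a cylinder of ratio
    kappa, have a horizontal distance of order kappa * rho ^ n and a distance at
    most of the same order, so that the quadratic error is negligible as soon as
    kappa is small ([transverse_positive]). *)

Set Implicit Arguments.
Unset Strict Implicit.
Unset Printing Implicit Defensive.

Import Order.TTheory GRing.Theory Num.Theory.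
Local Open Scope classical_set_scope.

(** * Hausdorff null sets *)

Section Geometric.
Variable R : realType.
Local Open Scope ring_scope.

Lemma exp_lt_eps (x e : R) : 0 <= x < 1 -> 0 < e -> exists n, x ^+ n < e.
Proof.
move=> /andP[x0 x1] e0.
have /(@cvgrPdist_lt _ R^o)/(_ e e0)[n _ /(_ n (leqnn n))] := @cvg_expr R x
  ltac:(by rewrite ger0_norm).
by rewrite sub0r normrN /= ger0_norm ?exprn_ge0//; exists n.
Qed.

End Geometric.

Section HausdorffNull.
Variables (R : realType) (T : metricType R).
Local Open Scope ring_scope.
Implicit Types (t e delta : R) (A B : set T).

Lemma diameter_pow_ge0 t A : (0 <= diameter_pow t A)%E.
Proof. by rewrite /diameter_pow; case: ifP => // _; exact: poweR_ge0. Qed.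

Lemma diameter_pow0 t : diameter_pow t (@set0 T) = 0%E.
Proof. by rewrite /diameter_pow ifT//; apply/asboolP. Qed.

Lemma diameter_powE t A x : A x -> diameter_pow t A = poweR (diameter A) t.
Proof.
by move=> Ax; rewrite /diameter_pow ifF//; apply/asboolP => A0; rewrite A0 in Ax.
Qed.

Lemma mdist_le_diameter A x y : A x -> A y -> ((mdist x y)%:E <= diameter A)%E.
Proof. by move=> Ax Ay; apply: ereal_sup_ubound; exists x => //; exists y. Qed.

Lemma diameter_le A (D : \bar R) :
  (forall x y, A x -> A y -> ((mdist x y)%:E <= D)%E) -> (diameter A <= D)%E.
Proof. by move=> H; apply: ge_ereal_sup => _ [x Ax [y Ay <-]]; exact: H. Qed.

Lemma hausdorff_measure0P t A : hausdorff_measure t A = 0%E <->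
  forall delta e, 0 < delta -> 0 < e -> exists V : nat -> set T,
    [/\ A `<=` \bigcup_n V n, forall n, (diameter (V n) <= delta%:E)%E &
        (\sum_(0 <= n <oo) diameter_pow t (V n) <= e%:E)%E].
Proof.
have pre_ge0 delta : (0 <= hausdorff_premeasure t delta A)%E.
  apply: le_ereal_inf_tmp => _ [V _ <-].
  by apply: nneseries_ge0 => n _ _; exact: diameter_pow_ge0.
split=> [H delta e d0 e0|H].
  have : (hausdorff_premeasure t delta A < e%:E)%E.
    apply: (@le_lt_trans _ _ 0%E); last by rewrite lte_fin.
    by rewrite -H; apply: ereal_sup_ubound; exists delta.
  move=> /ereal_inf_lt[_ [V [AV Vd] <-]] /ltW Ve.
  by exists V.
apply/eqP; rewrite eq_le; apply/andP; split.
  apply: ge_ereal_sup => _ [delta d0 <-].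
  apply/lee_addgt0Pr => e e0; rewrite add0e.
  have [V [AV Vd Ve]] := H delta e d0 e0.
  by apply: le_trans Ve; apply: ereal_inf_lbound; exists V.
apply: le_trans (pre_ge0 1) _; apply: ereal_sup_ubound.
by exists 1 => //=; exact: ltr01.
Qed.

Lemma hausdorff_null_sub t A B :
  A `<=` B -> hausdorff_measure t B = 0%E -> hausdorff_measure t A = 0%E.
Proof.
move=> AB /hausdorff_measure0P H; apply/hausdorff_measure0P => delta e d0 e0.
by have [V [BV ? ?]] := H delta e d0 e0; exists V; split=> //; apply: subset_trans BV.
Qed.

(** Covers of the sets with total weights e / 2 ^ (n + 1) are merged along a
    bijection of nat with nat * nat. *)
Lemma hausdorff_null_bigcup t (A : nat -> set T) :
  (forall n, hausdorff_measure t (A n) = 0%E) ->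
  hausdorff_measure t (\bigcup_n A n) = 0%E.
Proof.
move=> A0; apply/hausdorff_measure0P => delta e d0 e0.
have /choice[V HV] : forall n, exists V : nat -> set T,
    [/\ A n `<=` \bigcup_n V n, forall n, (diameter (V n) <= delta%:E)%E &
        (\sum_(0 <= j <oo) diameter_pow t (V j) <= (e / (2 ^ n.+1)%:R)%:E)%E].
  move=> n; have /hausdorff_measure0P := A0 n; apply => //.
  by rewrite divr_gt0// ltr0n expn_gt0.
have [h /= hbij] : exists h : nat -> nat * nat, set_bij setT setT h.
  have /card_set_bijP[h] := card_esym card_nat2.
  by exists h.
exists (fun n => V (h n).1 (h n).2); split.
- move=> x [n _ Anx]; have [/(_ _ Anx)[j _ Vx] _ _] := HV n.
  have [_ _ /(_ (n, j) I)[i _ hi]] := hbij.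
  by exists i => //; rewrite hi.
- by move=> n; have [_ + _] := HV (h n).1; apply.
rewrite nneseries_esumT; last by move=> n; exact: diameter_pow_ge0.
rewrite -(@reindex_esum _ _ _ setT setT h (fun k => diameter_pow t (V k.1 k.2)))//.
have -> : [set: nat * nat] = setT `*`` (fun=> setT) by apply/seteqP; split.
rewrite -(@esum_esum _ _ _ setT (fun=> setT) (fun i j => diameter_pow t (V i j)));
  last by move=> i j _ _; exact: diameter_pow_ge0.
apply: le_trans (epsilon_trick0 xpredT (ltW e0)).
rewrite nneseries_esumT; last first.
  by move=> n; rewrite lee_fin divr_ge0// ltW.
apply: le_esum => n _; rewrite -nneseries_esumT; last first.
  by move=> j; exact: diameter_pow_ge0.
by have [_ _] := HV n.
Qed.

End HausdorffNull.

Section Lipschitz.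
Variables (R : realType) (S T : metricType R).
Local Open Scope ring_scope.

Lemma hausdorff_null_lipschitz (t L : R) (phi : S -> T) (A : set S) :
  0 <= t -> 0 < L ->
  (forall x y, A x -> A y -> mdist (phi x) (phi y) <= L * mdist x y) ->
  hausdorff_measure t A = 0%E -> hausdorff_measure t (phi @` A) = 0%E.
Proof.
move=> t0 L0 lip /hausdorff_measure0P A0; apply/hausdorff_measure0P => delta e d0 e0.
have Lt0 : 0 < L `^ t by rewrite powR_gt0.
have [V [AV Vd Ve]] := A0 (delta / L) (e / L `^ t) (divr_gt0 d0 L0) (divr_gt0 e0 Lt0).
have diam n : (diameter (phi @` (V n `&` A)) <= L%:E * diameter (V n))%E.
  apply: diameter_le => _ _ [x [Vx Ax] <-] [y [Vy Ay] <-].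
  apply: (@le_trans _ _ (L * mdist x y)%:E); first by rewrite lee_fin lip.
  by rewrite EFinM lee_pmul2l// mdist_le_diameter.
exists (fun n => phi @` (V n `&` A)); split.
- by move=> _ [x Ax <-]; have [n _ Vx] := AV x Ax; exists n => //; exists x.
- move=> n; apply: le_trans (diam n) _.
  have -> : delta%:E = (L%:E * (delta / L)%:E)%E.
    by rewrite -EFinM mulrC divfK// gt_eqF.
  by rewrite lee_pmul2l.
apply: (@le_trans _ _ (\sum_(0 <= n <oo) (L `^ t)%:E * diameter_pow t (V n))%E).
  apply: lee_nneseries => [n _ _|n _]; first exact: diameter_pow_ge0.
  have [->|/eqP/set0P[_ [x [Vx Ax] _]]] := pselect (phi @` (V n `&` A) = set0).
    by rewrite diameter_pow0 mule_ge0 ?diameter_pow_ge0// lee_fin ltW.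
  rewrite (@diameter_powE _ _ _ _ (phi x)); last by exists x.
  rewrite (diameter_powE _ Vx).
  have D0 : (0 <= diameter (V n))%E.
    by apply: le_trans (mdist_le_diameter Vx Vx); rewrite lee_fin mdist_ge0.
  have DP : (0 <= diameter (phi @` (V n `&` A)))%E.
    apply: (@le_trans _ _ (mdist (phi x) (phi x))%:E).
      by rewrite lee_fin mdist_ge0.
    by apply: mdist_le_diameter; exists x.
  rewrite -poweR_EFin -poweRM ?lee_fin ?(ltW L0)//.
  apply: (gt0_ler_poweR t0) => //; rewrite in_itv/= ?leey ?andbT//.
  by rewrite mule_ge0// lee_fin ltW.
rewrite nneseriesZl; last by move=> n _; exact: diameter_pow_ge0.
apply: (@le_trans _ _ ((L `^ t)%:E * (e / L `^ t)%:E)%E); first by rewrite lee_pmul2l.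
by rewrite -EFinM mulrC divfK// gt_eqF.
Qed.

End Lipschitz.

Section MetricCompact.
Variables (R : realType) (T : metricType R).
Local Open Scope ring_scope.
Import metricType_numDomainType.

(** Infinitely many visits to each ball around p play the part of a convergent
    subsequence. *)
Lemma compact_sequence_cluster (K : set T) (z : nat -> T) :
  compact K -> (forall n, K (z n)) ->
  exists2 p, K p & forall n (e : R), 0 < e -> exists2 m, (n <= m)%N & mdist p (z m) < e.
Proof.
move=> cK Kz; have zK : (z @ \oo) K by exists 0%N => // n _; exact: Kz.
have [p [Kp clp]] := cK (z @ \oo) _ zK.
exists p => // n e e0.
have [||_ [[m nm <-] /= pz]] := clp (z @` [set m | (n <= m)%N]) [set y | mdist p y < e].
- by exists n => // m /= nm; exists m.
- by rewrite -filter_from_mdist_nbhs; exists e.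
by exists m.
Qed.

Lemma compact_mdist_bounded (K : set T) : compact K ->
  exists2 D : R, 0 < D & forall x y, K x -> K y -> mdist x y <= D.
Proof.
move=> cK; have [[x0 Kx0]|/forallNP K0] := pselect (exists x, K x); last first.
  by exists 1 => // x y /K0.
suff [D HD] : exists D, forall x, K x -> mdist x0 x <= D.
  exists (D + D + 1).
    by rewrite ltr_wpDl// -mulr2n mulrn_wge0// (le_trans _ (HD _ Kx0))// mdist_ge0.
  move=> x y Kx Ky; apply: (le_trans (metric_triangle x x0 y)).
  by rewrite metric_sym ler_wpDr// lerD// HD.
apply: contrapT => /forallNP H.
have /choice[z Hz] : forall n : nat, exists x, K x /\ n%:R < mdist x0 x.
  move=> n; have /existsNP[x /not_implyP[Kx /negP]] := H n%:R.
  by rewrite -ltNge; exists x.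
have [p Kp clp] := compact_sequence_cluster cK (fun n => (Hz n).1).
have [m + pm] := clp (Num.bound (mdist x0 p + 1)) 1 ltr01.
have := archi_boundP (addr_ge0 (mdist_ge0 x0 p) ler01).
move=> /ltW h1; rewrite -(ler_nat R) => h2.
have := (Hz m).2; apply/negP; rewrite -leNgt.
apply: le_trans (le_trans h1 h2).
by rewrite (le_trans (metric_triangle x0 p _))// lerD2l ltW.
Qed.

Lemma hausdorff_null_finite_cover (t : R) (A : set T) :
  (forall delta e : R, 0 < delta -> 0 < e ->
    exists (I : finType) (V : I -> set T),
    [/\ forall x, A x -> exists i, V i x, forall i, (diameter (V i) <= delta%:E)%E &
        (\sum_i diameter_pow t (V i) <= e%:E)%E]) ->
  hausdorff_measure t A = 0%E.
Proof.
move=> H; apply/hausdorff_measure0P => delta e d0 e0.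
have [I [V [AV Vd Ve]]] := H delta e d0 e0.
pose W n := if insub n is Some j then V (@enum_val I predT j) else set0.
exists W; split.
- move=> x /AV[i Vix]; exists (enum_rank i) => //.
  by rewrite /W valK enum_rankK.
- move=> n; rewrite /W; case: insub => // .
  by apply: diameter_le => x y [].
- apply: le_trans Ve; rewrite (nneseries_split 0 #|I|)//; last first.
    by move=> n _; exact: diameter_pow_ge0.
  rewrite add0n [X in (_ + X)%E]eseries0 ?adde0.
    rewrite big_mkord [leRHS](reindex (@enum_val I predT))/=; last first.
      exact/onW_bij/enum_val_bij.
    by apply: lee_sum => j _; rewrite /W valK.
  by move=> n /= In _; rewrite /W insubF ?diameter_pow0// ltnNge In.
Qed.

End MetricCompact.

(** * Sets coded by a separated tree *)

Section Greedy.
Variables (R : realType) (m : nat).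
Local Open Scope ring_scope.

(** Countable subadditivity of the uniform probability on the sequences. The
    sequence is built letter by letter, always keeping to a cylinder that the
    given ones do not fill, so that no measure has to be constructed. *)
Lemma avoid_cylinders (l : nat -> nat) (a : nat -> nat -> 'I_m) :
  (\sum_(0 <= n <oo) ((m%:R ^- l n : R)%:E) < 1)%E ->
  exists b : nat -> 'I_m, forall n, exists2 i, (i < l n)%N & b i != a n i.
Proof.
move=> sum_lt1; have m_gt0 : (0 < m)%N by case: (m) (a 0%N 0%N) => [[]|].
have mV n : 0 <= m%:R ^- n :> R by rewrite invr_ge0 exprn_ge0.
have mass_split j : m%:R ^- j = \sum_(x : 'I_m) m%:R ^- j.+1 :> R.
  rewrite sumr_const card_ord -[RHS]mulr_natr exprS invfM mulrAC mulVf ?mul1r//.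
  by rewrite pnatr_eq0 -lt0n.
(* the mass of the n-th cylinder inside the cylinder of depth j around v, for
   the uniform measure; v only matters below j *)
pose w j (v : nat -> 'I_m) n : R :=
  if `[< forall i, (i < minn (l n) j)%N -> v i = a n i >]
  then m%:R ^- maxn (l n) j else 0.
have w_ge0 j v n : 0 <= w j v n by rewrite /w; case: ifP.
pose upd j v x : nat -> 'I_m := fun i : nat => if i == j then x else v i.
have w_split j v n : w j v n = \sum_x w j.+1 (upd j v x) n.
  rewrite /w; case: (boolP (l n <= j)%N) => lj; last rewrite -ltnNge in lj.
    have -> : minn (l n) j = l n by apply/minn_idPl.
    have -> : minn (l n) j.+1 = l n by apply/minn_idPl; rewrite ltnW.
    have -> : maxn (l n) j = j by apply/maxn_idPr.
    have -> : maxn (l n) j.+1 = j.+1 by apply/maxn_idPr; rewrite ltnW.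
    have E x : `[< forall i, (i < l n)%N -> upd j v x i = a n i >] =
               `[< forall i, (i < l n)%N -> v i = a n i >].
      apply: asbool_equiv_eq; split => + i il => /(_ i il);
      by rewrite /upd (ltn_eqF (leq_trans il lj)).
    under eq_bigr do rewrite E.
    case: ifP => _; last by rewrite big1.
    exact: mass_split.
  have -> : minn (l n) j = j by apply/minn_idPr; rewrite ltnW.
  have -> : minn (l n) j.+1 = j.+1 by apply/minn_idPr.
  have -> : maxn (l n) j = l n by apply/maxn_idPl; rewrite ltnW.
  have -> : maxn (l n) j.+1 = l n by apply/maxn_idPl.
  have E x : `[< forall i, (i < j.+1)%N -> upd j v x i = a n i >] =
      `[< forall i, (i < j)%N -> v i = a n i >] && (x == a n j).
    apply/asboolP/andP => [H|[/asboolP H /eqP xa] i].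
      split; last by apply/eqP; rewrite -(H j)// /upd eqxx.
      by apply/asboolP => i ij; rewrite -(H i) 1?ltnW// /upd ltn_eqF.
    by rewrite ltnS leq_eqVlt /upd; case: eqVneq => [-> _|_ /= /H].
  under eq_bigr do rewrite E.
  case: ifP => /= _; last by rewrite big1.
  by rewrite -big_mkcond/= big_pred1_eq.
(* the n-th cylinders fill less than the cylinder of depth j around v, hence
   less than one of its m children: this is how the sequence is chosen *)
pose good j v := (\sum_(0 <= n <oo) (w j v n)%:E < (m%:R ^- j)%:E)%E.
have step j v : good j v -> exists x, good j.+1 (upd j v x).
  move=> gd; apply: contrapT => /forallNP H; move: gd; rewrite /good.
  apply/negP; rewrite -leNgt.
  rewrite (eq_eseriesr (g := fun n => \sum_x (w j.+1 (upd j v x) n)%:E))%E; last first.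
    by move=> n _; rewrite w_split sumEFin.
  rewrite nneseries_sum; last by move=> x n _; rewrite lee_fin.
  have -> : ((m%:R ^- j : R)%:E = \sum_(x : 'I_m) (m%:R ^- j.+1 : R)%:E)%E.
    by rewrite sumEFin -mass_split.
  by apply: lee_sum => x _; rewrite leNgt; apply/negP/H.
pose pick j v := if pselect (exists x, good j.+1 (upd j v x)) is left e
  then upd j v (sval (cid e)) else v.
pose vs := fix vs j := if j is j'.+1 then pick j' (vs j') else a 0%N.
have vs_good j : good j (vs j).
  elim: j => [|j /step ex] /=; last first.
    by rewrite /pick; case: pselect => // e; case: cid.
  rewrite /good expr0 invr1; apply: le_lt_trans sum_lt1.
  apply: lee_nneseries => n _; first by rewrite lee_fin.
  by rewrite lee_fin /w maxn0; case: ifP.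
have vs_stable i j k : (i < j)%N -> vs (j + k)%N i = vs j i.
  move=> ij; elim: k => [|k <-]; first by rewrite addn0.
  rewrite addnS /= /pick; case: pselect => // e; rewrite /upd ifF//.
  by rewrite ltn_eqF// ltn_addr.
(* at depth l n the n-th cylinder, if it contained the sequence, would fill the
   whole cylinder around it *)
exists (fun i => vs i.+1 i) => n; apply: contrapT => H.
have := vs_good (l n); apply/negP; rewrite -leNgt.
have -> : m%:R ^- l n = w (l n) (vs (l n)) n.
  rewrite /w minnn maxnn ifT//; apply/asboolP => i il.
  apply: contra_notP H => /eqP neq; exists i => //.
  by rewrite -(@vs_stable i i.+1 (l n - i.+1)%N) ?subnKC.
apply: le_trans (nneseries_lim_ge n.+1 _); last first.
  by move=> i _ _; rewrite lee_fin.
rewrite big_nat_recr//= leeDr// sume_ge0// => i _.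
by rewrite lee_fin.
Qed.
End Greedy.

Section LowerBound.
Variables (R : realType).
Local Open Scope ring_scope.

Lemma first_difference (T : eqType) (a b : nat -> T) i :
  a i != b i -> exists n, [/\ (n <= i)%N, forall j, (j < n)%N -> a j = b j & a n != b n].
Proof.
move=> abi; have ex : exists n, a n != b n by exists i.
exists (ex_minn ex); case: ex_minnP => n abn min; split => //; first exact: min.
by move=> j jn; apply/eqP; apply: contraTT jn => /min; rewrite -leqNgt.
Qed.

(** The mass distribution principle: a set of small diameter that meets the
    family lies over a single cylinder, whose mass m ^- l is at most rho ^ (t l),
    and this is comparable to the t-th power of the diameter. A cover of total
    weight less than a constant would thus give cylinders of total mass less
    than 1. *)
Lemma separated_coding_hausdorff (T : metricType R) (A : set T) (m : nat)
    (p : (nat -> 'I_m) -> T) (t c rho : R) :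
  0 <= t -> 0 < c -> 0 < rho < 1 -> (2 <= m)%N -> 1 <= m%:R * rho `^ t ->
  (forall a, A (p a)) ->
  (forall a b n, (forall i, (i < n)%N -> a i = b i) -> a n != b n ->
     c * rho ^+ n <= mdist (p a) (p b)) ->
  hausdorff_measure t A <> 0%E.
Proof.
move=> t0 c0 /andP[rho0 rho1] m2 mrho Ap sep /hausdorff_measure0P A0.
pose K : R := c^-1 `^ t; have K0 : 0 < K by rewrite /K powR_gt0 ?invr_gt0.
have [V [AV Vd Ve]] := A0 1 ((4 * K)^-1) ltr01 ltac:(by rewrite invr_gt0 mulr_gt0).
have m0 : 0 < m%:R :> R by rewrite ltr0n (leq_trans _ m2).
have m_small n : exists l, m%:R ^- l <= 4^-1 / (2 ^ n.+1)%:R :> R.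
  have [||l /ltW H] := @exp_lt_eps R m%:R^-1 (4^-1 / (2 ^ n.+1)%:R).
  - by rewrite invr_ge0 ltW//= invf_lt1// ltr1n.
  - by rewrite divr_gt0// ltr0n expn_gt0.
  - by exists l; rewrite -exprVn.
(* the points of V n agree on their first l places, where l is the largest
   depth allowed by the separation; when V n has diameter 0 or misses the
   family, l is taken large, whence the second term of the bound *)
have level n : exists la : nat * (nat -> 'I_m),
    (forall b, V n (p b) -> forall i, (i < la.1)%N -> b i = la.2 i) /\
    ((m%:R ^- la.1)%:E <= K%:E * diameter_pow t (V n)
                          + (4^-1 / (2 ^ n.+1)%:R)%:E)%E.
  have [l0 l0P] := m_small n.
  have Kd : (0 <= K%:E * diameter_pow t (V n))%E.
    by rewrite mule_ge0 ?diameter_pow_ge0// lee_fin ltW.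
  have [[b0 Vb0]|/forallNP none] := pselect (exists b, V n (p b)); last first.
    exists (l0, fun=> Ordinal m2) => /=; split=> [b /none//|].
    by apply: (@le_trans _ _ (4^-1 / (2 ^ n.+1)%:R)%:E); rewrite ?lee_fin// leeDr.
  have dge0 : (0 <= diameter (V n))%E.
    by apply: le_trans (mdist_le_diameter Vb0 Vb0); rewrite lee_fin mdist_ge0.
  have dfin : diameter (V n) \is a fin_num.
    by rewrite ge0_fin_numE// (le_lt_trans (Vd n))// ltry.
  have [D DE] : exists D, diameter (V n) = D%:E.
    by exists (fine (diameter (V n))); rewrite fineK.
  rewrite DE lee_fin in dge0.
  have agree l : (forall i, (i < l)%N -> D < c * rho ^+ i) ->
      forall b, V n (p b) -> forall i, (i < l)%N -> b i = b0 i.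
    move=> Dl b Vb i il; apply/eqP/negPn/negP => /first_difference[j [ji jb bj]].
    have := mdist_le_diameter Vb Vb0; rewrite DE lee_fin.
    apply/negP; rewrite -ltNge; apply: lt_le_trans (sep _ _ _ jb bj).
    by apply: Dl; apply: leq_ltn_trans il.
  have [D0|D0] := eqVneq D 0.
    exists (l0, b0) => /=; split.
      by apply: agree => i _; rewrite D0 mulr_gt0// exprn_gt0.
    by apply: (@le_trans _ _ (4^-1 / (2 ^ n.+1)%:R)%:E); rewrite ?lee_fin// leeDr.
  have {D0 dge0} Dgt0 : 0 < D by rewrite lt_neqAle eq_sym D0.
  have ex : exists l, c * rho ^+ l <= D.
    have [||l /ltW H] := @exp_lt_eps R rho (D / c).
    - by rewrite ltW.
    - by rewrite divr_gt0.
    - by exists l; rewrite mulrC -ler_pdivlMr.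
  exists (ex_minn ex, b0) => /=; case: ex_minnP => l lD lmin; split.
    by apply: agree => i il; rewrite ltNge; apply: contraL il => /lmin; rewrite -leqNgt.
  apply: (@le_trans _ _ (K%:E * diameter_pow t (V n))%E); last first.
    by rewrite leeDl// lee_fin divr_ge0.
  rewrite (diameter_powE _ Vb0) DE poweR_EFin -EFinM lee_fin.
  apply: (@le_trans _ _ ((rho ^+ l) `^ t)).
    have -> : (rho ^+ l) `^ t = (rho `^ t) ^+ l.
      by rewrite -(powR_mulrn l (powR_ge0 _ _)) -(powR_mulrn l (ltW rho0)) powRAC.
    by rewrite -[leLHS]mulr1 ler_pdivrMl ?exprn_gt0// -exprMn exprn_ege1.
  rewrite /K mulrC -powRM ?invr_ge0 ?(ltW c0) ?(ltW Dgt0)//.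
  rewrite ge0_ler_powR// ?nnegrE ?exprn_ge0 ?divr_ge0 ?(ltW rho0) ?(ltW c0) ?(ltW Dgt0)//.
  by rewrite ler_pdivlMr// mulrC.
have {level} [la laP] := choice level.
have [|b bP] := @avoid_cylinders R m (fun n => (la n).1) (fun n => (la n).2).
  apply: (@le_lt_trans _ _ (K%:E * ((4 * K)^-1)%:E + (4^-1)%:E)%E); last first.
    rewrite -EFinM -EFinD lte_fin invfM mulrCA divff ?gt_eqF// mulr1. lra.
  apply: (@le_trans _ _ (\sum_(0 <= n <oo) (K%:E * diameter_pow t (V n)
                          + (4^-1 / (2 ^ n.+1)%:R)%:E))%E).
    apply: lee_nneseries => [n _ _|n _]; last by have [] := laP n.
    by rewrite lee_fin invr_ge0 exprn_ge0// ltW.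
  apply: le_trans (epsilon_trick _ _ _) _ => //.
    by move=> n; rewrite mule_ge0 ?diameter_pow_ge0// lee_fin ltW.
  rewrite leeD2r// nneseriesZl; last by move=> n _; exact: diameter_pow_ge0.
  by rewrite lee_pmul2l.
have [n _ Vb] := AV _ (Ap b); have [i il /eqP] := bP n; apply.
by have [+ _] := laP n; apply.
Qed.

End LowerBound.

(** * Attractors of iterated function systems of similarities *)

Section SimilarityIFS.
Variables (R : realType) (k : nat) (r : 'I_k -> R).
Local Open Scope ring_scope.
Hypothesis r01 : forall i, 0 < r i < 1.

Definition word_ratio (w : seq 'I_k) : R := \prod_(i <- w) r i.

(** The pressure at t is 1 exactly when t is the similarity dimension. *)
Definition pressure (t : R) : R := \sum_i r i `^ t.

Lemma ratio_gt0 i : 0 < r i. Proof. by case/andP: (r01 i). Qed.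

Lemma word_ratio_gt0 w : 0 < word_ratio w.
Proof. by apply: prodr_gt0 => i _; exact: ratio_gt0. Qed.

Lemma word_ratio_cat u v : word_ratio (u ++ v) = word_ratio u * word_ratio v.
Proof. exact: big_cat. Qed.

Lemma max_ratio : exists2 q, 0 <= q < 1 & forall w, word_ratio w <= q ^+ size w.
Proof.
pose q := \big[Num.max/0]_i r i.
have q1 : q < 1 by apply: bigmax_lt => // i _; case/andP: (r01 i).
have rq i : r i <= q by exact: le_bigmax.
exists q.
  by rewrite q1 andbT; elim/big_rec: q {q1 rq} => // i x _ x0; rewrite le_max x0 orbT.
elim=> [|i w IHw]; first by rewrite /word_ratio big_nil.
rewrite /word_ratio big_cons exprS ler_pM// ?(ltW (word_ratio_gt0 w))//.
by rewrite ltW// ratio_gt0.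
Qed.

Lemma word_ratio_powR t w : word_ratio w `^ t = \prod_(i <- w) r i `^ t.
Proof.
elim: w => [|i w IHw]; first by rewrite /word_ratio !big_nil powR1.
by rewrite big_cons -IHw /word_ratio big_cons powRM// ltW// ?ratio_gt0 ?word_ratio_gt0.
Qed.

(** Words of a given length as functions, so that the sum over them of a product
    over letters is the expansion of a power of a sum. *)
Definition ffword n (a : {ffun 'I_n -> 'I_k}) : seq 'I_k := [seq a i | i <- enum 'I_n].

Lemma size_ffword n (a : {ffun 'I_n -> 'I_k}) : size (ffword a) = n.
Proof. by rewrite size_map size_enum_ord. Qed.

Lemma ffword_surj (w : seq 'I_k) : exists a : {ffun 'I_(size w) -> 'I_k}, ffword a = w.
Proof.
exists [ffun i => tnth (in_tuple w) i].
rewrite /ffword; under eq_map do rewrite ffunE.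
by rewrite map_tnth_enum.
Qed.

Lemma ffword_inj n : injective (@ffword n).
Proof.
move=> a b /eq_in_map ab; apply/ffunP => i.
by apply: ab; rewrite mem_enum.
Qed.

Lemma word_ratio_count (w : seq 'I_k) :
  word_ratio w = \prod_i r i ^+ count_mem i w.
Proof.
rewrite /word_ratio; elim: w => [|j w IHw].
  by rewrite big_nil big1// => i _; rewrite expr0.
rewrite big_cons IHw (bigD1 j)//= [RHS](bigD1 j)//= eqxx add1n exprS mulrA.
congr (_ * _); apply: eq_bigr => i ij.
by rewrite eq_sym (negPf ij) add0n.
Qed.

Lemma sum_word_ratio t n :
  \sum_(a : {ffun 'I_n -> 'I_k}) word_ratio (ffword a) `^ t = pressure t ^+ n.
Proof.
have -> : pressure t ^+ n = \prod_(j < n) pressure t by rewrite prodr_const card_ord.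
rewrite bigA_distr_bigA; apply: eq_bigr => a _.
by rewrite word_ratio_powR big_map big_enum.
Qed.

Variables (T : metricType R) (g : 'I_k -> T -> T).
Hypothesis g_sim : forall i x y, mdist (g i x) (g i y) = r i * mdist x y.

Lemma mdist_word w x y :
  mdist (foldr g x w) (foldr g y w) = word_ratio w * mdist x y.
Proof.
rewrite /word_ratio; elim: w => [|i w IHw] /=; first by rewrite big_nil mul1r.
by rewrite g_sim IHw big_cons mulrA.
Qed.

Variable K : set T.
Hypothesis K_attr : is_attractor g K.

Lemma word_stable w x : K x -> K (foldr g x w).
Proof.
move=> Kx; case: K_attr => _ _ KE; elim: w => //= i w IHw.
by rewrite KE; exists i => //; exists (foldr g x w).
Qed.

Lemma attractor_address n x : K x ->
  exists w y, [/\ size w = n, K y & x = foldr g y w].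
Proof.
elim: n x => [|n IHn] x; first by exists [::], x.
case: K_attr => _ _ {1}->; move=> [i _ [y /IHn[w [z [wn Kz ->]]] <-]].
by exists (i :: w), z; rewrite /= wn.
Qed.

(** The cylinders of generation n cover, have diameter at most q ^ n * D and
    weights of sum at most D ^ t * P(t) ^ n. *)
Lemma attractor_null t : 0 <= t -> pressure t < 1 -> hausdorff_measure t K = 0%E.
Proof.
move=> t0 P1; case: (K_attr) => _ cK _.
have P0 : 0 <= pressure t by apply: sumr_ge0 => i _; exact: powR_ge0.
have [D D0 HD] := compact_mdist_bounded cK.
have [q /andP[q0 q1] Hq] := max_ratio.
have Dt0 : 0 < D `^ t by rewrite powR_gt0.
apply: hausdorff_null_finite_cover => delta e d0 e0.
have [|n1 Hn1] := @exp_lt_eps R q (delta / D) _ (divr_gt0 d0 D0); first by rewrite q0.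
have [|n2 Hn2] := @exp_lt_eps R (pressure t) (e / D `^ t) _ (divr_gt0 e0 Dt0).
  by rewrite P0.
pose n := maxn n1 n2.
have diam (w : seq 'I_k) :
    (diameter ((fun x => foldr g x w) @` K) <= (word_ratio w * D)%:E)%E.
  apply: diameter_le => _ _ [x Kx <-] [y Ky <-].
  by rewrite lee_fin mdist_word ler_pM2l ?word_ratio_gt0 ?HD.
exists {ffun 'I_n -> 'I_k}, (fun a => (fun x => foldr g x (ffword a)) @` K); split.
- move=> x /(attractor_address n)[w [y [wn Ky ->]]]; rewrite -wn.
  by have [a aw] := ffword_surj w; exists a; exists y; rewrite // aw.
- move=> a; apply: le_trans (diam _) _; rewrite lee_fin.
  rewrite -ler_pdivlMr//; apply: le_trans (Hq _) _; apply: le_trans (ltW Hn1).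
  by rewrite size_ffword ler_wiXn2l ?leq_maxl// ltW.
apply: (@le_trans _ _ (\sum_(a : {ffun 'I_n -> 'I_k})
    (D `^ t * word_ratio (ffword a) `^ t)%:E)%E).
  apply: lee_sum => a _; case: (K_attr) => -[x Kx] _ _.
  rewrite (@diameter_powE _ _ _ _ (foldr g x (ffword a))); last by exists x.
  rewrite -powRM ?(ltW D0) ?(ltW (word_ratio_gt0 _))// -poweR_EFin.
  apply: gt0_ler_poweR => //; last by rewrite mulrC diam.
    rewrite in_itv/= leey andbT.
    apply: (@le_trans _ _ (mdist (foldr g x (ffword a)) (foldr g x (ffword a)))%:E).
      by rewrite lee_fin mdist_ge0.
    by apply: mdist_le_diameter; exists x.
  by rewrite in_itv/= leey andbT lee_fin mulr_ge0// ltW// word_ratio_gt0.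
rewrite sumEFin lee_fin -mulr_sumr sum_word_ratio mulrC -ler_pdivlMr//.
by apply: le_trans (ltW Hn2); rewrite ler_wiXn2l ?leq_maxr// ltW.
Qed.

Lemma word_continuous w : continuous (fun x => foldr g x w).
Proof.
move=> x; apply/metricType_numDomainType.cvgrPdist_lt => e e0.
apply/metricType_numDomainType.nbhs_mdistP.
exists (e / word_ratio w); first by rewrite /= divr_gt0 ?word_ratio_gt0.
by move=> y /=; rewrite mdist_word ltr_pdivlMr ?word_ratio_gt0// mulrC.
Qed.

(** A cluster point of the orbit of any point of K lies in each of the nested
    cylinders, as these are closed. *)
Lemma attractor_coding (W : nat -> seq 'I_k) : exists2 p, K p &
  forall n, exists2 y, K y & p = foldr g y (flatten (mkseq W n)).
Proof.
case: (K_attr) => -[x0 Kx0] cK _.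
pose z n := foldr g x0 (flatten (mkseq W n)).
have Kz n : K (z n) by exact: word_stable.
have [p Kp clp] := compact_sequence_cluster cK Kz.
exists p => // n; pose C := (fun x => foldr g x (flatten (mkseq W n))) @` K.
have : C p; last by move=> [y Ky <-]; exists y.
have : closed C.
  apply: compact_closed; first exact: metric_hausdorff.
  apply: continuous_compact => //; apply: continuous_subspaceT.
  exact: word_continuous.
apply => B; rewrite -metricType_numDomainType.filter_from_mdist_nbhs => -[e e0 eB].
have [m nm pm] := clp n e e0.
exists (z m); split; last exact: eB.
exists (foldr g x0 (flatten (map W (iota n (m - n))))); first exact: word_stable.
by rewrite -foldr_cat -flatten_cat -map_cat -iotaD subnKC.
Qed.

End SimilarityIFS.

Section Critical.
Variables (R : realType) (k : nat) (r : 'I_k -> R).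
Local Open Scope ring_scope.
Hypothesis r01 : forall i, 0 < r i < 1.

(** Every ratio is at most q < 1, so P(t + e) <= q ^ e * P(t). *)
Lemma pressure_decreasing t e : 0 < e -> pressure r t <= 1 -> pressure r (t + e) < 1.
Proof.
move=> e0 P1; have [q /andP[q0 q1] Hq] := max_ratio r01.
have rq i : r i <= q by have := Hq [:: i]; rewrite /word_ratio big_seq1 expr1.
have qe : q `^ e < 1.
  have [->|qn0] := eqVneq q 0; first by rewrite powR0 ?gt_eqF.
  have : q `^ e < 1 `^ e by apply: gt0_ltr_powR; rewrite ?nnegrE.
  by rewrite powR1.
apply: (@le_lt_trans _ _ (pressure r t * q `^ e)).
  rewrite mulr_suml; apply: ler_sum => i _.
  have ri0 := ratio_gt0 r01 i.
  rewrite powRD; last by rewrite (gt_eqF ri0) implybT.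
  by rewrite ler_wpM2l ?powR_ge0// ge0_ler_powR ?nnegrE ?(ltW e0)// ltW.
by apply: le_lt_trans qe; rewrite ler_piMl ?powR_ge0.
Qed.

(** By strict monotonicity at most one t escapes both assumptions, and it does not
    change the infimum. *)
Lemma hausdorff_dim_pressure (T : metricType R) (A : set T) :
  (forall t, 0 <= t -> pressure r t < 1 -> hausdorff_measure t A = 0%E) ->
  (forall t, 0 <= t -> 1 < pressure r t -> hausdorff_measure t A <> 0%E) ->
  hausdorff_dim A = ereal_inf [set s%:E | s in [set s : R | 0 <= s /\ pressure r s < 1]].
Proof.
move=> null pos; apply/eqP; rewrite eq_le; apply/andP; split.
  apply: ereal_inf_le_tmp => _ [s [s0 sP] <-].
  by exists s => //; split => //; exact: null.
apply: le_ereal_inf_tmp => _ [s [s0 sA] <-].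
apply/lee_addgt0Pr => e e0; apply: ereal_inf_lbound; exists (s + e) => //.
split; first by rewrite addr_ge0// ltW.
apply: pressure_decreasing => //; rewrite leNgt; apply/negP => /(pos _ s0); exact.
Qed.

End Critical.


(** * Separated cylinders under the open set condition *)

Section RealCoordinates.
Variables (R : realType) (d : nat).
Local Open Scope ring_scope.
Implicit Types z : cspace R d.

Definition rcoord (j : 'I_d * bool) z : R :=
  if j.2 then complex.Re (ccoord z j.1) else complex.Im (ccoord z j.1).

Lemma normc_sqr (z : R[i]) : Normc.normc z ^+ 2 = complex.Re z ^+ 2 + complex.Im z ^+ 2.
Proof. by case: z => a b; rewrite /= sqr_sqrtr// addr_ge0// sqr_ge0. Qed.

Lemma ReB (z w : R[i]) : complex.Re (z - w) = complex.Re z - complex.Re w.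
Proof. by case: z; case: w. Qed.

Lemma ImB (z w : R[i]) : complex.Im (z - w) = complex.Im z - complex.Im w.
Proof. by case: z; case: w. Qed.

Lemma mdist_cspaceE z z' :
  mdist z z' ^+ 2 = \sum_i ((rcoord (i, true) z - rcoord (i, true) z') ^+ 2 +
                           (rcoord (i, false) z - rcoord (i, false) z') ^+ 2).
Proof.
rewrite [mdist z z']/(hdist (ccoord z) (ccoord z')) hnorm_sqr.
by apply: eq_bigr => i _; rewrite normc_sqr ReB ImB.
Qed.

Lemma rcoord_le_mdist j z z' : `|rcoord j z - rcoord j z'| <= mdist z z'.
Proof.
rewrite -ler_sqr ?nnegrE ?mdist_ge0// real_normK ?num_real// mdist_cspaceE.
rewrite (bigD1 j.1)//= -[leLHS]addr0 lerD ?sumr_ge0// => [|i _]; last first.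
  by rewrite addr_ge0 ?sqr_ge0.
by case: j => i [] /=; [rewrite lerDl|rewrite lerDr]; rewrite sqr_ge0.
Qed.

Lemma mdist_lt_rcoord (s : R) z z' : 0 < s ->
  (forall j, `|rcoord j z - rcoord j z'| < s) -> mdist z z' < (2 * d + 1)%:R * s.
Proof.
move=> s0 H; rewrite -ltr_sqr ?nnegrE ?mdist_ge0 ?mulr_ge0 ?(ltW s0)//.
rewrite mdist_cspaceE; apply: (@le_lt_trans _ _ (\sum_(i < d) (s ^+ 2 + s ^+ 2))).
  apply: ler_sum => i _; rewrite lerD// -[leLHS]real_normK ?num_real//;
  by rewrite ler_sqr ?nnegrE ?(ltW s0)// ltW// H.
rewrite sumr_const card_ord -[ltLHS]mulr_natr exprMn -mulr2n -[s ^+ 2 *+ 2]mulr_natr.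
rewrite -mulrA -natrM mulrC ltr_pM2r ?exprn_gt0// -natrX ltr_nat.
by rewrite -mulnn; nia.
Qed.

End RealCoordinates.

Section RealEstimates.
Variable R : realType.
Local Open Scope ring_scope.

Lemma bernoulli_ge (x : R) n : 0 <= x -> 1 + n%:R * x <= (1 + x) ^+ n.
Proof.
move=> x0; elim: n => [|n IHn]; first by rewrite mul0r addr0 expr0.
rewrite exprS; apply: le_trans (ler_wpM2l _ IHn); last by rewrite addr_ge0.
rewrite -natr1 mulrDl mulrDr mul1r mulr1 mulrDl !mul1r.
have : 0 <= x * (n%:R * x) by rewrite !mulr_ge0.
lra.
Qed.

(** Along n = m (k + 1), Bernoulli's inequality bounds x ^ n below by a multiple
    of m ^ (k + 1). *)
Lemma exp_dominates_poly (x C : R) k : 1 < x ->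
  exists n, (0 < n)%N /\ C * n.+1%:R ^+ k <= x ^+ n.
Proof.
move=> x1; pose y := x - 1; have y0 : 0 < y by rewrite subr_gt0.
have [m Hm] : exists m, `|C| * k.+2%:R ^+ k / y ^+ k.+1 < m%:R.
  exists (Num.bound (`|C| * k.+2%:R ^+ k / y ^+ k.+1)); apply: archi_boundP.
  by rewrite divr_ge0 ?mulr_ge0 ?exprn_ge0// ltW.
have m0 : (0 < m)%N.
  rewrite -(ltr_nat R); apply: le_lt_trans Hm.
  by rewrite divr_ge0 ?mulr_ge0 ?exprn_ge0// ltW.
exists (m * k.+1)%N; split; first by rewrite muln_gt0 m0.
apply: (@le_trans _ _ (`|C| * (m%:R * k.+2%:R) ^+ k)).
  rewrite (le_trans (ler_norm _))// normrM ler_wpM2l// normrX lerXn2r ?nnegrE//.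
  by rewrite ger0_norm// -natrM ler_nat; nia.
apply: (@le_trans _ _ ((m%:R * y) ^+ k.+1)).
  move: Hm; rewrite ltr_pdivrMr ?exprn_gt0// => /ltW.
  move=> /(ler_wpM2r (exprn_ge0 k (ler0n R m))).
  by rewrite !exprMn [m%:R ^+ k.+1]exprS; congr (_ <= _); ring.
rewrite exprM lerXn2r ?nnegrE ?mulr_ge0 ?exprn_ge0 ?(ltW y0)//; first lra.
have := bernoulli_ge m (ltW y0); rewrite /y; have -> : 1 + (x - 1) = x by ring.
lra.
Qed.

(** Distinct integers that are congruent modulo M differ by at least M, and each
    floor is within 1 of its number. *)
Lemma floor_eqmod_dist (M : nat) (u v : R) :
  Num.floor u != Num.floor v -> (Num.floor u = Num.floor v %[mod M%:Z])%Z ->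
  (M%:R - 1) <= `|u - v|.
Proof.
move=> neq /eqP; rewrite eqz_mod_dvd => /dvdzP[q qE].
have q0 : q != 0 by apply: contraNneq neq => q0; rewrite -subr_eq0 qE q0 mul0r.
have q1 : 1 <= `|q|%:~R :> R by rewrite -[1]/(1%:~R) ler_int; lia.
have : (M%:R : R) <= `|(Num.floor u)%:~R - (Num.floor v)%:~R|.
  rewrite -intrB qE intrM normrM -intr_norm.
  by rewrite [X in _ <= _ * X]ger0_norm ?ler_peMl.
have [u1 u2] := (real_floor_le (num_real u), real_floorD1_gt (num_real u)).
have [v1 v2] := (real_floor_le (num_real v), real_floorD1_gt (num_real v)).
rewrite !intrD in u2 v2.
move=> H; apply: (@le_trans _ _ (`|(Num.floor u)%:~R - (Num.floor v)%:~R| - 1)).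
  by rewrite lerD2r.
have [h|h] := ger0P ((Num.floor u)%:~R - (Num.floor v)%:~R : R).
  by apply: le_trans (ler_norm _); lra.
by rewrite -normrN; apply: le_trans (ler_norm _); lra.
Qed.

End RealEstimates.

Section OpenSetCondition.
Variables (R : realType) (d k : nat) (r : 'I_k -> R).
Variable f : 'I_k -> cspace R d -> cspace R d.
Local Open Scope ring_scope.
Hypothesis r01 : forall i, 0 < r i < 1.
Hypothesis f_sim : forall i x y, mdist (f i x) (f i y) = r i * mdist x y.
Hypothesis f_surj : forall i y, exists x, f i x = y.

Lemma word_surj w y : exists x, foldr f x w = y.
Proof.
elim: w y => [|i w IHw] y; first by exists y.
by have [z <-] := f_surj i y; have [x <-] := IHw z; exists x.
Qed.

(** At the first place where the words differ the images are disjoint by the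
    open set condition; the common outer maps are injective. *)
Lemma osc_words_disjoint (U : set (cspace R d)) :
  (forall i, f i @` U `<=` U) ->
  (forall i j, i != j -> f i @` U `&` f j @` U = set0) ->
  forall v w x y, size v = size w -> v != w -> U x -> U y ->
  foldr f x v != foldr f y w.
Proof.
move=> fU disj.
have stable w x : U x -> U (foldr f x w).
  by move=> Ux; elim: w => //= i w IHw; apply: (fU i); exists (foldr f x w).
elim=> [|i v IHv] [|j w] // x y [svw] neq Ux Uy /=.
have [ij|ij] := eqVneq i j.
  rewrite -ij in neq *; apply/eqP => E.
  have {}neq : v != w by apply: contraNneq neq => ->.
  have /eqP := IHv w x y svw neq Ux Uy; apply.
  apply: mdist_positivity; apply/eqP; have /eqP := f_sim i (foldr f x v) (foldr f y w).
  rewrite E mdistxx eq_sym mulf_eq0 gt_eqF//.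
  by case/andP: (r01 i).
apply/eqP => E; suff : (f i @` U `&` f j @` U) (f i (foldr f x v)) by rewrite disj.
by split; [exists (foldr f x v)|rewrite E; exists (foldr f y w)] => //; exact: stable.
Qed.

(** The pigeonhole principle replaces the count of the cylinders of comparable
    size that are near a given one: words are coloured so that equal colours
    force equal ratios and far away cylinders, and the number of colours grows
    slower than the total weight P(t) ^ n. *)
Lemma osc_separated_words (Y : set (cspace R d)) (t D : R) :
  0 <= t -> open_set_condition f ->
  (forall x y, Y x -> Y y -> mdist x y <= D) ->
  1 < pressure r t ->
  exists n (W : {set {ffun 'I_n -> 'I_k}}) (rho : R),
    [/\ 0 < rho < 1, 2 <= #|W|%:R * rho `^ t, forall a, a \in W -> word_ratio r (ffword a) = rho &
      forall a b x y, a \in W -> b \in W -> a != b -> Y x -> Y y ->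
        rho <= mdist (foldr f x (ffword a)) (foldr f y (ffword b))].
Proof.
move=> t0 [U [[z0 Uz0] Uo fU disj]] YD P1.
have /metricType_numDomainType.nbhs_mdistP[eta eta0 Ueta] : nbhs z0 U.
  exact: open_nbhs_nbhs.
rewrite /= in eta0.
(* words of equal ratio rho have centres at distance at least rho * eta, since
   the ball of radius eta around z0 is mapped onto that of radius rho * eta *)
have centre n (a b : {ffun 'I_n -> 'I_k}) rho : a != b ->
    word_ratio r (ffword a) = rho -> word_ratio r (ffword b) = rho ->
    rho * eta <= mdist (foldr f z0 (ffword a)) (foldr f z0 (ffword b)).
  move=> ab ra rb; rewrite leNgt; apply/negP => H.
  have [z zE] := word_surj (ffword a) (foldr f z0 (ffword b)).
  move: H; rewrite -zE (mdist_word f_sim) ra ltr_pM2l -?ra ?word_ratio_gt0// => /Ueta Uz.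
  have := osc_words_disjoint fU disj (v := ffword a) (w := ffword b) _ _ Uz Uz0.
  rewrite !size_ffword => /(_ erefl); rewrite zE eqxx => H; apply/notF/H.
  by apply: contra ab => /eqP/ffword_inj ->.
have [D' D'0 HD'] : exists2 D', 0 <= D' & forall y, Y y -> mdist z0 y <= D'.
  have [[y0 Yy0]|/forallNP nY] := pselect (exists y, Y y).
    exists (mdist z0 y0 + D).
      by rewrite addr_ge0 ?mdist_ge0// (le_trans _ (YD _ _ Yy0 Yy0))// mdist_ge0.
    by move=> y Yy; rewrite (le_trans (metric_triangle z0 y0 y))// lerD2l YD.
  by exists 0 => // y /nY.
(* cells of side rho * sigma contain at most one centre of ratio rho *)
pose sigma := eta / (2 * d + 1)%:R.
have sigma0 : 0 < sigma by rewrite divr_gt0// ltr0n addn1.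
(* centres M cells apart are at distance at least (2 * D' + 1) * rho, which
   leaves rho between the images of Y *)
pose M := Num.bound ((2 * D' + 1) / sigma).
have HM : (2 * D' + 1) / sigma < M%:R.
  apply: archi_boundP; rewrite divr_ge0 ?(ltW sigma0)//.
  by rewrite addr_ge0// mulr_ge0.
(* a word is coloured by the number of occurrences of each letter, which gives
   its ratio, and by the cell of its centre modulo M + 1; the number of colours
   is polynomial in n, so that some colour carries a weight of at least 2 *)
have [n [n0 Hn]] := exp_dominates_poly (3 * (M.+1 ^ #|{: 'I_d * bool}|)%:R) k P1.
pose colour := ({ffun 'I_k -> 'I_n.+1} * {ffun 'I_d * bool -> 'I_M.+1})%type.
pose coord (a : {ffun 'I_n -> 'I_k}) j :=
  rcoord j (foldr f z0 (ffword a)) / (word_ratio r (ffword a) * sigma).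
pose col (a : {ffun 'I_n -> 'I_k}) : colour :=
  ([ffun i => inord (count_mem i (ffword a))],
   [ffun j => inord `|(Num.floor (coord a j) %% M.+1)%Z|%N]).
have ratioP a b : col a = col b -> word_ratio r (ffword a) = word_ratio r (ffword b).
  move=> /(congr1 fst) /= /ffunP ab; rewrite !word_ratio_count.
  apply: eq_bigr => i _; congr (_ ^+ _); move/(congr1 val): (ab i); rewrite !ffunE /=.
  by rewrite !inordK// ltnS (leq_trans (count_size _ _))// size_ffword.
have cellP a b j : col a = col b ->
    (Num.floor (coord a j) = Num.floor (coord b j) %[mod M.+1])%Z.
  move=> /(congr1 snd) /= /ffunP/(_ j) /(congr1 val); rewrite !ffunE /=.
  have small x : (`|(x %% M.+1)%Z| < M.+1)%N.
    by have := ltz_pmod x (isT : 0 < M.+1%:Z); have := modz_ge0 x (isT : M.+1%:Z != 0); lia.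
  rewrite !inordK ?small// => E.
  by have := modz_ge0 (Num.floor (coord a j)) (isT : M.+1%:Z != 0);
    have := modz_ge0 (Num.floor (coord b j)) (isT : M.+1%:Z != 0); lia.
have [c Hc] : exists c, 2 <= \sum_(a | col a == c) word_ratio r (ffword a) `^ t.
  apply: contrapT => /forallNP H.
  have : pressure r t ^+ n <= 2 * #|{: colour}|%:R.
    rewrite -(sum_word_ratio r01) (partition_big col predT)//= mulrC mulr_natl -sumr_const.
    by apply: ler_sum => c _; rewrite ltW// ltNge; apply/negP/H.
  apply/negP; rewrite -ltNge; apply: lt_le_trans Hn.
  rewrite card_prod !card_ffun !card_ord natrM -!natrX mulrA mulrAC.
  by rewrite -!mulrA ltr_pM2r ?ltr_nat// -!natrM ltr0n muln_gt0 !expn_gt0.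
pose W := finset (fun a : {ffun 'I_n -> 'I_k} => col a == c).
have [a0 a0W] : exists a0, a0 \in W.
  apply: contrapT => /forallNP H; move: Hc; rewrite big_pred0 => [|a]; last first.
    by apply/negP => Ha; apply: (H a); rewrite inE.
  by rewrite lern0.
pose rho := word_ratio r (ffword a0).
have rW a : a \in W -> word_ratio r (ffword a) = rho.
  by move: a0W; rewrite !inE => /eqP h /eqP h'; apply: ratioP; rewrite h h'.
have rho0 : 0 < rho by exact: word_ratio_gt0.
exists n, W, rho; split => //.
- rewrite rho0/=; have [q /andP[q0 q1] /(_ (ffword a0)) Hq] := max_ratio r01.
  by apply: le_lt_trans Hq _; rewrite size_ffword exprn_ilt1// -lt0n.
- apply: le_trans Hc _; rewrite mulr_natl -sumr_const le_eqVlt; apply/orP; left; apply/eqP.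
  by apply: eq_big => [a|a /eqP ac]; rewrite ?inE// rW// inE ac.
move=> a b x y aW bW ab Yx Yy.
(* two words of the same colour lie in different cells, hence M + 1 cells apart
   in some coordinate *)
have far : (2 * D' + 1) * rho <= mdist (foldr f z0 (ffword a)) (foldr f z0 (ffword b)).
  have scale0 : 0 < rho * sigma by rewrite mulr_gt0.
  have colab : col a = col b by move: aW bW; rewrite !inE => /eqP-> /eqP->.
  have coordB j : `|rcoord j (foldr f z0 (ffword a)) - rcoord j (foldr f z0 (ffword b))| =
      `|coord a j - coord b j| * (rho * sigma).
    rewrite /coord !rW// -mulrBl normrM [`|_^-1|]gtr0_norm ?invr_gt0//.
    by rewrite divfK// gt_eqF.
  have [[j jab]|/forallNP same] :=
      pselect (exists j, Num.floor (coord a j) != Num.floor (coord b j)).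
    have /(floor_eqmod_dist jab) := cellP a b j colab.
    rewrite -natr1 addrK => Mj; apply: le_trans (rcoord_le_mdist j _ _).
    rewrite coordB; apply: (@le_trans _ _ (M%:R * (rho * sigma))); last first.
      by rewrite ler_pM2r.
    by rewrite [rho * sigma]mulrC mulrA ler_pM2r// -ler_pdivrMr// ltW.
  exfalso; have := centre n a b rho ab (rW a aW) (rW b bW); apply/negP; rewrite -ltNge.
  have -> : rho * eta = (2 * d + 1)%:R * (rho * sigma).
    by rewrite /sigma mulrCA [X in _ = rho * X]mulrC divfK// pnatr_eq0 addn1.
  apply: mdist_lt_rcoord => // j; rewrite coordB -[ltRHS]mul1r ltr_pM2r//.
  have /negP := same j; rewrite negbK => /eqP fE.
  have [u1 u2] := (real_floor_le (num_real (coord a j)), real_floorD1_gt (num_real (coord a j))).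
  have [v1 v2] := (real_floor_le (num_real (coord b j)), real_floorD1_gt (num_real (coord b j))).
  by rewrite !intrD fE in u1 u2 v2; rewrite ltr_norml; apply/andP; split; lra.
have := metric_triangle (foldr f z0 (ffword a)) (foldr f x (ffword a)) (foldr f z0 (ffword b)).
have := metric_triangle (foldr f x (ffword a)) (foldr f y (ffword b)) (foldr f z0 (ffword b)).
rewrite [mdist (foldr f y _) (foldr f z0 _)]metric_sym !(mdist_word f_sim) !rW//.
have := ler_wpM2l (ltW rho0) (HD' x Yx); have := ler_wpM2l (ltW rho0) (HD' y Yy).
lra.
Qed.



End OpenSetCondition.

(** * The Heisenberg group and the radial chart *)

Section HeisenbergChart.
Variables (R : realType) (d : nat).
Local Open Scope ring_scope.
Local Notation nc := (@Normc.normc R).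
Implicit Types (u v w : cspace R d) (g h : heis R d).

Lemma ccoordD u v k : ccoord (u + v) k = ccoord u k + ccoord v k.
Proof. by rewrite /ccoord mxE. Qed.

Lemma ccoordN u k : ccoord (- u) k = - ccoord u k.
Proof. by rewrite /ccoord mxE. Qed.

Lemma ccoordZ (c : R[i]) u k : ccoord (c *: u) k = c * ccoord u k.
Proof. by rewrite /ccoord mxE. Qed.

Lemma cspace_eqP u v : (forall k, ccoord u k = ccoord v k) -> u = v.
Proof. by move=> uv; apply/rowP. Qed.

Lemma mdist_cnorm u v : mdist u v = cnorm (u - v).
Proof. by rewrite [LHS]/(hdist _ _); apply: eq_hnorm => k; rewrite ccoordD ccoordN. Qed.

Lemma cnormN u : cnorm (- u) = cnorm u.
Proof. by rewrite /cnorm -[RHS]Defs.hnormN; apply: eq_hnorm => k; rewrite ccoordN. Qed.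

Lemma cnorm_ge0 u : 0 <= cnorm u. Proof. exact: hnorm_ge0. Qed.

Lemma cnorm_sqrE u : cnorm u ^+ 2 = \sum_k nc (ccoord u k) ^+ 2.
Proof. exact: hnorm_sqr. Qed.

Lemma conj_mul_normc (z : R[i]) : (z^*)%C * z = ((nc z ^+ 2)%:C)%C.
Proof.
rewrite normc_sqr; case: z => a b; apply/eqP; rewrite eq_complex /=.
by apply/andP; split; apply/eqP; ring.
Qed.

Lemma cnormZ (c : R[i]) u : cnorm (c *: u) = nc c * cnorm u.
Proof.
apply/eqP; rewrite -(eqrXn2 (n := 2))// ?mulr_ge0 ?cnorm_ge0 ?normc_ge0//.
rewrite exprMn !cnorm_sqrE mulr_sumr; apply/eqP; apply: eq_bigr => k _.
by rewrite ccoordZ Normc.normcM exprMn.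
Qed.

Lemma cnormD u v : cnorm (u + v) <= cnorm u + cnorm v.
Proof.
rewrite (le_trans _ (Defs.hnormD (ccoord u) (ccoord v)))// le_eqVlt.
by apply/orP; left; apply/eqP; apply: eq_hnorm => k; rewrite ccoordD.
Qed.

Lemma cdotDl u v w : cdot (u + v) w = cdot u w + cdot v w.
Proof. by rewrite -big_split; apply: eq_bigr => i _; rewrite ccoordD rmorphD mulrDl. Qed.

Lemma cdotDr u v w : cdot w (u + v) = cdot w u + cdot w v.
Proof. by rewrite -big_split; apply: eq_bigr => i _; rewrite ccoordD mulrDr. Qed.

Lemma cdotNl u v : cdot (- u) v = - cdot u v.
Proof. by rewrite -sumrN; apply: eq_bigr => i _; rewrite ccoordN rmorphN mulNr. Qed.

Lemma cdotxx u : cdot u u = ((cnorm u ^+ 2)%:C)%C.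
Proof.
rewrite cnorm_sqrE rmorph_sum/=; apply: eq_bigr => k _.
exact: conj_mul_normc.
Qed.

Lemma cdotC u v : cdot u v = ((cdot v u)^*)%C.
Proof.
rewrite /cdot /hdot rmorph_sum/=; apply: eq_bigr => i _.
by rewrite rmorphM/= conjcK mulrC.
Qed.

Lemma cnormD_sqr u v :
  cnorm (u + v) ^+ 2 = cnorm u ^+ 2 + cnorm v ^+ 2 + 2 * complex.Re (cdot u v).
Proof.
have /(congr1 (@complex.Re R)) := cdotxx (u + v).
rewrite cdotDl !cdotDr !cdotxx (cdotC v u); case: (cdot u v) => a b /= <-.
ring.
Qed.

Lemma omegaNl u v : omega (- u) v = - omega u v.
Proof. by rewrite /omega cdotNl; case: (cdot u v). Qed.

(** Twice the modulus of this complex gauge is the square of the Koranyi gauge.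
    It is also the Hermitian product of the vectors of g and of the identity. *)
Definition gaugeC g : R[i] := ((cnorm (hvec g) ^+ 2 / 2) +i* (- hht g))%C.

Lemma koranyi_gauge_sqr g : koranyi_gauge g ^+ 2 = 2 * nc (gaugeC g).
Proof.
rewrite sqr_sqrtr ?sqrtr_ge0//=.
have -> : cnorm (hvec g) ^+ 4 + 4 * hht g ^+ 2 =
    2 ^+ 2 * ((cnorm (hvec g) ^+ 2 / 2) ^+ 2 + (- hht g) ^+ 2) by field.
by rewrite sqrtrM ?sqr_ge0// sqrtr_sqr ger0_norm.
Qed.

Lemma mdist_heisE g h : mdist g h = koranyi_gauge (g^-1 * h)%g. Proof. by []. Qed.

Lemma koranyi_gauge_ge0 g : 0 <= koranyi_gauge g. Proof. exact: sqrtr_ge0. Qed.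

Lemma gauge_mdist1 g : koranyi_gauge g = mdist (1%g : heis R d) g.
Proof. by rewrite mdist_heisE invg1 mul1g. Qed.

Lemma mdist_heis_mull g h h' : mdist (g * h)%g (g * h')%g = mdist h h'.
Proof. by rewrite !mdist_heisE invgM -mulgA mulKg. Qed.

Lemma gaugeC_neq0 g : g != 1%g -> gaugeC g != 0.
Proof.
apply: contra_neq => g0; apply/esym/mdist_positivity.
rewrite -gauge_mdist1; apply/eqP; rewrite -(eqrXn2 (n := 2)) ?koranyi_gauge_ge0//.
by rewrite koranyi_gauge_sqr g0 Normc.normc0 mulr0 expr0n.
Qed.

Lemma cnorm_le_gauge g : cnorm (hvec g) <= koranyi_gauge g.
Proof.
rewrite -ler_sqr ?nnegrE ?cnorm_ge0 ?koranyi_gauge_ge0// koranyi_gauge_sqr.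
rewrite -ler_pdivrMl// mulrC -[leLHS]ger0_norm ?divr_ge0 ?sqr_ge0// -sqrtr_sqr.
by rewrite ler_wsqrtr// lerDl sqr_ge0.
Qed.

Lemma hvecM g h : hvec (g * h)%g = hvec g + hvec h. Proof. by []. Qed.

Lemma hvecV g : hvec g^-1%g = - hvec g. Proof. by []. Qed.

Lemma mdist_hvec g h : mdist (hvec g) (hvec h) <= mdist g h.
Proof.
by rewrite mdist_cnorm -cnormN opprB addrC; apply: cnorm_le_gauge (g^-1 * h)%g.
Qed.

(** The cocycle of the group law is the imaginary part of u . v, and the expansion
    of |u + v| ^ 2 contributes the real part. *)
Lemma gaugeCM g h : gaugeC (g * h)%g =
  gaugeC g + gaugeC h + cdot (hvec g) (hvec h).
Proof.
rewrite /gaugeC hvecM cnormD_sqr /= /omega; case: (cdot _ _) => a b.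
by apply/eqP; rewrite eq_complex/=; apply/andP; split; apply/eqP; field.
Qed.

(** The radial projection from the identity, up to an injective affine map: its
    fibres are the chains through the identity. *)
Definition chart g : cspace R d := (gaugeC g)^-1 *: hvec g.

(** On the orthogonal of u the map multiplies by q, and on the line of u by
    q - |u|^2, which is minus the conjugate of q: it is |q| times an isometry. *)
Lemma chart_isometry g v :
  cnorm (gaugeC g *: v - cdot (hvec g) v *: hvec g) = nc (gaugeC g) * cnorm v.
Proof.
set q := gaugeC g; set u := hvec g; set s := cdot u v.
apply/eqP; rewrite -(eqrXn2 (n := 2))// ?mulr_ge0 ?cnorm_ge0 ?normc_ge0//; apply/eqP.
rewrite cnormD_sqr cnormN !cnormZ.
have -> : cdot (q *: v) (- (s *: u)) = - ((q^*)%C * s * (s^*)%C).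
  rewrite /s [((cdot u v)^*)%C](esym (cdotC v u)) /cdot /hdot.
  rewrite -mulrA mulrCA mulrA [in RHS]mulr_sumr -sumrN.
  apply: eq_bigr => k _; rewrite ccoordN !ccoordZ rmorphM/= /cdot /hdot. ring.
have -> : (q^*)%C * s * (s^*)%C = (q^*)%C * ((nc s ^+ 2)%:C)%C.
  by rewrite -mulrA [s * _]mulrC conj_mul_normc.
rewrite !exprMn.
have -> : complex.Re (- ((q^*)%C * ((nc s ^+ 2)%:C)%C)) = - (cnorm u ^+ 2 / 2 * nc s ^+ 2).
  by rewrite /q /gaugeC /=; ring.
by field.
Qed.

Lemma chart_diff g h : g != 1%g -> (g * h)%g != 1%g ->
  chart (g * h)%g - chart g = (gaugeC g * gaugeC (g * h)%g)^-1 *: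
   ((gaugeC g *: hvec h - cdot (hvec g) (hvec h) *: hvec g) - gaugeC h *: hvec g).
Proof.
move=> /gaugeC_neq0 g0 /gaugeC_neq0 gh0; apply: cspace_eqP => k.
rewrite /chart hvecM !(ccoordD, ccoordN, ccoordZ).
move: g0 gh0; rewrite gaugeCM; set q := gaugeC g; set p := gaugeC h; set s := cdot _ _.
by move=> g0 gh0; field; rewrite gh0 g0.
Qed.

Lemma normc_gt0 (z : R[i]) : z != 0 -> 0 < nc z.
Proof.
move=> z0; rewrite lt_neqAle normc_ge0 andbT eq_sym.
by apply: contra_neq z0; exact: Normc.eq0_normc.
Qed.

Lemma normcV (z : R[i]) : nc z^-1 = (nc z)^-1.
Proof.
have [->|z0] := eqVneq z 0; first by rewrite invr0 Normc.normc0 invr0.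
have zn : nc z != 0 by rewrite gt_eqF// normc_gt0.
by apply: (mulfI zn); rewrite -Normc.normcM !divff ?Normc.normc1.
Qed.

Lemma cnormB_dist u v : `|cnorm (u - v) - cnorm u| <= cnorm v.
Proof.
have := cnormD u (- v); rewrite cnormN.
have := cnormD (u - v) v; rewrite subrK.
by move=> h1 h2; rewrite ler_norml; apply/andP; split; lra.
Qed.

(** The chart is, at small scales, the projection to C^d followed by a
    similarity of ratio 1 / |q|: the vertical part of the increment only enters
    through gaugeC (g^-1 * h), whose modulus is half the squared distance. *)
Lemma chart_dist g h : g != 1%g -> h != 1%g ->
  `|mdist (chart h) (chart g) - mdist (hvec h) (hvec g) / nc (gaugeC h)| <=
  mdist g h ^+ 2 * (cnorm (hvec g) / (2 * nc (gaugeC g) * nc (gaugeC h))).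
Proof.
move=> g1 h1; have hE : h = (g * (g^-1 * h))%g by rewrite mulVKg.
have q0 := normc_gt0 (gaugeC_neq0 g1); have q'0 := normc_gt0 (gaugeC_neq0 h1).
rewrite !mdist_cnorm mdist_heisE koranyi_gauge_sqr.
have -> : hvec h - hvec g = hvec (g^-1 * h)%g by rewrite hvecM hvecV addrC.
have := chart_diff g1 (h := (g^-1 * h)%g); rewrite -hE => /(_ h1) ->.
rewrite cnormZ normcV Normc.normcM.
set v := hvec (g^-1 * h)%g; set p := gaugeC (g^-1 * h)%g.
set X := gaugeC g *: v - _.
have := cnormB_dist X (p *: hvec g); rewrite chart_isometry cnormZ.
set Z := cnorm (X - _) => HZ.
have -> : (nc (gaugeC g) * nc (gaugeC h))^-1 * Z - cnorm v / nc (gaugeC h) =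
    (Z - nc (gaugeC g) * cnorm v) / (nc (gaugeC g) * nc (gaugeC h)).
  by field; rewrite !gt_eqF.
rewrite normrM normfV (gtr0_norm (mulr_gt0 q0 q'0)) ler_pdivrMr ?mulr_gt0//.
apply: le_trans HZ _; rewrite le_eqVlt; apply/orP; left; apply/eqP.
by field; rewrite !gt_eqF.
Qed.

End HeisenbergChart.

(** * Exterior products *)

Section ExteriorProducts.
Variables (R : realType) (n : nat).
Local Open Scope ring_scope.
Local Notation vec := 'rV[R[i]]_n.+1.
Local Notation E := (extalg R n.+1).
Implicit Types (x y : vec) (u v : E) (J : {set 'I_n.+1}) (c : R[i]).

Lemma ecoordD u v J : ecoord (u + v) J = ecoord u J + ecoord v J.
Proof. by rewrite /ecoord ffunE. Qed.

Lemma ecoordZ c u J : ecoord (c *: u) J = c * ecoord u J.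
Proof. by rewrite /ecoord ffunE. Qed.

Lemma ecoord_inj u v : (forall J, ecoord u J = ecoord v J) -> u = v.
Proof. by move=> uv; apply/ffunP. Qed.

Definition vee_sign J (j : 'I_n.+1) : R[i] := (-1) ^+ #|[pred i in J | (i < j)%N]|.

Lemma ecoord_vee x u J : ecoord (vee x u) J =
  \sum_(j in J) vee_sign J j * x ord0 j * ecoord u (J :\ j)%SET.
Proof. by rewrite /ecoord ffunE. Qed.

Lemma veeDr x u v : vee x (u + v) = vee x u + vee x v.
Proof.
apply: ecoord_inj => J; rewrite ecoordD !ecoord_vee -big_split/=.
by apply: eq_bigr => j _; rewrite ecoordD mulrDr.
Qed.

Lemma veeZr x c u : vee x (c *: u) = c *: vee x u.
Proof.
apply: ecoord_inj => J; rewrite ecoordZ !ecoord_vee mulr_sumr.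
by apply: eq_bigr => j _; rewrite ecoordZ mulrCA.
Qed.

Lemma veeDl x y u : vee (x + y) u = vee x u + vee y u.
Proof.
apply: ecoord_inj => J; rewrite ecoordD !ecoord_vee -big_split/=.
by apply: eq_bigr => j _; rewrite mxE mulrDr mulrDl.
Qed.

Lemma veeZl x c u : vee (c *: x) u = c *: vee x u.
Proof.
apply: ecoord_inj => J; rewrite ecoordZ !ecoord_vee mulr_sumr.
by apply: eq_bigr => j _; rewrite mxE; ring.
Qed.

Lemma vee0r x : vee x 0 = 0.
Proof. by rewrite -[X in vee _ X](scale0r 0) veeZr scale0r. Qed.

Lemma veeNr x u : vee x (- u) = - vee x u.
Proof. by rewrite -(scaleN1r u) veeZr scaleN1r. Qed.

Lemma vee_sumr (I : finType) x (G : I -> E) : vee x (\sum_i G i) = \sum_i vee x (G i).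
Proof. by apply: (big_morph (vee x) (veeDr x) (vee0r x)). Qed.

Lemma vee_signD1 J i j : i \in J -> i != j ->
  vee_sign J j = (-1) ^+ (i < j)%N * vee_sign (J :\ i)%SET j.
Proof.
move=> iJ ij; rewrite /vee_sign -exprD; congr (_ ^+ _).
rewrite (cardD1 i) !inE iJ/=; congr (_ + _)%N.
by apply: eq_card => l; rewrite !inE andbA.
Qed.

(** Exchanging the two removed indices changes exactly one of the two signs. *)
Lemma vee_anticomm x y u : vee x (vee y u) = - vee y (vee x u).
Proof.
apply: ecoord_inj => J; rewrite -scaleN1r ecoordZ mulN1r !ecoord_vee -sumrN.
under eq_bigr do rewrite ecoord_vee mulr_sumr.
under [RHS]eq_bigr do rewrite ecoord_vee mulr_sumr -sumrN.
rewrite (exchange_big_dep (mem J))/=; last by move=> i j _; rewrite !inE => /andP[].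
apply: eq_bigr => i iJ; apply: eq_big => [j|j /andP[jJ]].
  by rewrite !inE iJ andbT eq_sym andbC.
rewrite !inE => /andP[ij _].
have -> : (J :\ j :\ i = J :\ i :\ j)%SET by rewrite finset.setDDl finset.setUC -finset.setDDl.
rewrite (vee_signD1 iJ ij) (vee_signD1 jJ _) 1?eq_sym//.
have : (i < j)%N != (j < i)%N by move: ij; rewrite -val_eqE /=; case: ltngtP.
by case: (i < j)%N; case: (j < i)%N => // _; rewrite ?expr0 ?expr1; ring.
Qed.

Lemma vee_vee x u : vee x (vee x u) = 0.
Proof.
have /eqP := vee_anticomm x x u.
by rewrite -addr_eq0 -mulr2n -scaler_nat scaler_eq0 pnatr_eq0 => /eqP.
Qed.

Lemma vees0 (V : 'M[R[i]]_(0, n.+1)) : vees V = ext1 R n.+1.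
Proof. by rewrite /vees enum_ord0. Qed.

Lemma veesS p (V : 'M[R[i]]_(p.+1, n.+1)) :
  vees V = vee (row ord0 V) (vees (row' ord0 V)).
Proof.
rewrite /vees enum_ordSl /= -map_comp; congr (vee _ (foldr _ _ _)).
by apply: eq_map => i /=; apply/rowP => j; rewrite !mxE.
Qed.

Lemma vee_row_vees p (V : 'M[R[i]]_(p, n.+1)) k : vee (row k V) (vees V) = 0.
Proof.
elim: p V k => [|p IHp] V k; first by case: k.
rewrite veesS; case: (unliftP ord0 k) => [j ->|->]; last exact: vee_vee.
have -> : row (lift ord0 j) V = row j (row' ord0 V) by apply/rowP => i; rewrite !mxE.
by rewrite vee_anticomm IHp vee0r oppr0.
Qed.

(** The product of the vectors b_i + F_i x is affine in F: a term with two
    factors x vanishes. *)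
Lemma vees_add_rank1 p (B : 'M[R[i]]_(p, n.+1)) x :
  exists alpha : 'I_p -> E, forall F : 'cV[R[i]]_p,
    vees (B + F *m x) = vees B + vee x (\sum_i F i ord0 *: alpha i).
Proof.
elim: p B => [|p IHp] B.
  by exists (fun=> 0) => F; rewrite !vees0 big_ord0 vee0r addr0.
have [alpha Halpha] := IHp (row' ord0 B).
exists (fun i => if unlift ord0 i is Some j then - vee (row ord0 B) (alpha j)
                 else vees (row' ord0 B)) => F.
rewrite !veesS.
have -> : row ord0 (B + F *m x) = row ord0 B + F ord0 ord0 *: x.
  by apply/rowP => j; rewrite !mxE big_ord1.
have -> : row' ord0 (B + F *m x) = row' ord0 B + row' ord0 F *m x.
  by apply/matrixP => i j; rewrite !mxE !big_ord1 !mxE.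
rewrite Halpha veeDl !veeDr veeZl veeZl vee_vee scaler0 addr0 -addrA; congr (_ + _).
rewrite big_ord_recl unlift_none veeDr veeZr addrC; congr (_ + _).
rewrite vee_anticomm -veeNr vee_sumr; congr (vee _ _).
rewrite -sumrN; apply: eq_bigr => i _.
by rewrite liftK veeZr scalerN mxE.
Qed.

End ExteriorProducts.

Section Minors.
Variables (R : realType) (n : nat).
Local Open Scope ring_scope.
Local Notation vec := 'rV[R[i]]_n.+1.
Local Notation E := (extalg R n.+1).
Implicit Types (x : vec) (u v : E) (J : {set 'I_n.+1}).

Lemma sorted_enum J : sorted (fun i j : 'I_n.+1 => (i < j)%N) (enum J).
Proof.
rewrite {1}/enum_mem -enumT; apply: sorted_filter; first by move=> a b c; exact: ltn_trans.
by have := iota_ltn_sorted 0 n.+1; rewrite -val_enum_ord sorted_map.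
Qed.

Lemma card_below_nth_enum J j : (j < #|J|)%N ->
  #|[pred i in J | (i < nth ord0 (enum J) j)%N]| = j.
Proof.
move=> jJ; set e := enum J; set x := nth ord0 e j.
have sz : (j < size e)%N by rewrite -cardE.
have -> : #|[pred i in J | (i < x)%N]| = count (fun i : 'I_n.+1 => (i < x)%N) e.
  rewrite -size_filter cardE; congr size; rewrite /e {1 2}/enum_mem -filter_predI.
  by apply: eq_filter => i /=; rewrite andbC.
have eE : e = take j e ++ x :: drop j.+1 e by rewrite -drop_nth// cat_take_drop.
have := sorted_enum J; rewrite -/e eE sorted_pairwise; last first.
  by move=> a b c; exact: ltn_trans.
rewrite pairwise_cat pairwise_cons allrel_consr => /and3P[/andP[/allP tx _] _ /andP[/allP xd _]].
rewrite count_cat /= ltnn add0n -[RHS](size_takel (ltnW sz)).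
rewrite (eq_in_count (a2 := xpredT)) ?count_predT; last by move=> i /tx ->.
rewrite (eq_in_count (a2 := xpred0)) ?count_pred0 ?addn0//.
by move=> i /xd /ltnW; rewrite leqNgt => /negbTE.
Qed.

Lemma nth_enum_setD1 J j l : (j < #|J|)%N ->
  nth ord0 (enum (J :\ nth ord0 (enum J) j)%SET) l = nth ord0 (enum J) (bump j l).
Proof.
move=> jJ; set e := enum J; set x := nth ord0 e j.
have sz : (j < size e)%N by rewrite -cardE.
have -> : enum (J :\ x)%SET = rem x e.
  rewrite rem_filter ?enum_uniq// /e {1 2}/enum_mem -filter_predI.
  by apply: eq_filter => i /=; rewrite !inE.
rewrite remE index_uniq ?enum_uniq// nth_cat size_takel ?(ltnW sz)// /bump.
by case: ltnP => lj; [rewrite nth_take|rewrite nth_drop addSn subnKC].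
Qed.

(** The definition of the product is the expansion of minors along their first
    row: this is the Plucker coordinate of the rows of V. *)
Lemma ecoord_vees p (V : 'M[R[i]]_(p, n.+1)) J : ecoord (vees V) J =
  if #|J| == p then \det (\matrix_(i < p, j < p) V i (nth ord0 (enum J) j)) else 0.
Proof.
elim: p V J => [|p IHp] V J.
  rewrite vees0 /ecoord ffunE finset.cards_eq0; case: ifP => // _.
  by rewrite det_mx00.
rewrite veesS ecoord_vee.
have [cJ|cJ] := eqVneq #|J| p.+1; last first.
  rewrite big1// => j jJ; rewrite IHp ifF ?mulr0//.
  by apply: contraNF cJ => /eqP E; rewrite (cardsD1 j) jJ E.
rewrite (expand_det_row _ ord0) -[LHS]big_enum/= (big_nth ord0) big_mkord -cardE cJ.
apply: eq_bigr => j _; set x := nth ord0 (enum J) j.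
have jJ : (j < #|J|)%N by rewrite cJ.
have xJ : x \in J by rewrite -mem_enum mem_nth// -cardE.
rewrite IHp ifT; last by rewrite -eqSS -cJ (cardsD1 x J) xJ.
rewrite /vee_sign card_below_nth_enum// /cofactor !mxE add0n mulrA [_ * V _ _]mulrC.
congr (_ * _ * \det _).
by apply/matrixP => a b; rewrite !mxE nth_enum_setD1.
Qed.

(** Minors on given columns are multiplied by the determinant of a change of
    basis; so the products of two bases of a subspace are proportional. *)
Lemma vees_mulmx p (A : 'M[R[i]]_p) (V : 'M[R[i]]_(p, n.+1)) :
  vees (A *m V) = \det A *: vees V.
Proof.
apply: ecoord_inj => J; rewrite ecoordZ !ecoord_vees.
case: ifP => _; last by rewrite mulr0.
rewrite -det_mulmx; congr (\det _).
by apply/matrixP => i j; rewrite !mxE; apply: eq_bigr => l _; rewrite mxE.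
Qed.

End Minors.

Section ExteriorNorm.
Variables (R : realType) (n : nat).
Local Open Scope ring_scope.
Local Notation vec := 'rV[R[i]]_n.+1.
Local Notation E := (extalg R n.+1).
Implicit Types (x : vec) (u v : E) (c : R[i]).
Local Notation nc := (@Normc.normc R).

Definition enorm u : R := hnorm (ecoord u).

Lemma mdist_extE u v : mdist u v = enorm (u - v).
Proof.
rewrite [LHS]/(hdist _ _); apply: eq_hnorm => J.
by rewrite ecoordD -(scaleN1r v) ecoordZ mulN1r.
Qed.

Lemma enormD u v : enorm (u + v) <= enorm u + enorm v.
Proof.
rewrite (le_trans _ (Defs.hnormD (ecoord u) (ecoord v)))// le_eqVlt; apply/orP; left; apply/eqP.
by apply: eq_hnorm => J; rewrite ecoordD.
Qed.

Lemma enormZ c u : enorm (c *: u) = nc c * enorm u.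
Proof.
apply/eqP; rewrite -(eqrXn2 (n := 2))// ?mulr_ge0 ?hnorm_ge0 ?normc_ge0//.
rewrite exprMn !hnorm_sqr mulr_sumr; apply/eqP; apply: eq_bigr => J _.
by rewrite ecoordZ Normc.normcM exprMn.
Qed.

Lemma enorm0 : enorm 0 = 0.
Proof. by rewrite -(scale0r 0) enormZ Normc.normc0 mul0r. Qed.

Lemma enorm_sum (I : finType) (G : I -> E) : enorm (\sum_i G i) <= \sum_i enorm (G i).
Proof.
elim/big_ind2: _ => [|u a v b ua vb|//]; first by rewrite enorm0.
by rewrite (le_trans (enormD _ _))// lerD.
Qed.

Lemma enorm_gt0 u : u != 0 -> 0 < enorm u.
Proof.
move=> u0; rewrite lt_neqAle hnorm_ge0 andbT eq_sym.
apply: contra_neq u0 => /hnorm_eq0 H; apply: ecoord_inj => J.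
by rewrite H /ecoord ffunE.
Qed.

Lemma le_hnorm (I : finType) (u : I -> R[i]) i : nc (u i) <= hnorm u.
Proof.
rewrite -ler_sqr ?nnegrE ?normc_ge0 ?hnorm_ge0// hnorm_sqr (bigD1 i)//=.
by rewrite lerDl sumr_ge0// => j _; rewrite sqr_ge0.
Qed.

Lemma hnorm_le_sum (I : finType) (u : I -> R[i]) : hnorm u <= \sum_i nc (u i).
Proof.
rewrite -ler_sqr ?nnegrE ?hnorm_ge0 ?sumr_ge0// => [|i _]; last exact: normc_ge0.
rewrite hnorm_sqr [leRHS]expr2 mulr_suml; apply: ler_sum => i _.
rewrite expr2 ler_wpM2l ?normc_ge0// (bigD1 i)//= lerDl sumr_ge0// => j _.
exact: normc_ge0.
Qed.

Lemma vee_bounded x : exists2 C : R, 0 < C & forall u, enorm (vee x u) <= C * enorm u.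
Proof.
pose S := \sum_j nc (x ord0 j).
have S0 : 0 <= S by apply: sumr_ge0 => j _; exact: normc_ge0.
exists (1 + \sum_(J : {set 'I_n.+1}) S).
  by rewrite ltr_pwDl// sumr_ge0.
move=> u; rewrite mulrDl mul1r ler_wpDl ?hnorm_ge0//.
apply: le_trans (hnorm_le_sum _) _; rewrite mulr_suml; apply: ler_sum => J _.
rewrite ecoord_vee big_mkcond/= (le_trans (normc_sum _))// /S mulr_suml.
apply: ler_sum => j _; case: ifP => _; last first.
  by rewrite Normc.normc0 mulr_ge0 ?normc_ge0 ?hnorm_ge0.
rewrite !Normc.normcM ler_pM ?normc_ge0 ?mulr_ge0 ?normc_ge0//; last exact: le_hnorm.
rewrite -[leRHS]mul1r ler_wpM2r ?normc_ge0// /vee_sign.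
by elim: (#|_|) => [|m IH]; rewrite ?expr0 ?Normc.normc1// exprS mulN1r normcN.
Qed.

End ExteriorNorm.

(** * The radial projection in the chart *)

Section RadialProjection.
Variables (R : realType) (d : nat).
Local Open Scope ring_scope.
Local Notation vec := 'rV[R[i]]_d.+2.
Local Notation nc := (@Normc.normc R).
Implicit Types (x y z : vec) (h : heis R d).

Definition mid (k : 'I_d) : 'I_d.+2 := lift ord0 (lift ord_max k).
Arguments mid : simpl never.

Lemma ord_max_lift : ord_max = lift ord0 ord_max :> 'I_d.+2.
Proof. exact: val_inj. Qed.

Lemma val_mid k : mid k = k.+1 :> nat.
Proof. by rewrite lift0 lift_max. Qed.

Lemma mid_neq0 k : (mid k == ord0) = false.
Proof. by []. Qed.

Lemma mid_neq_max k : (mid k == ord_max) = false.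
Proof. by rewrite ord_max_lift (inj_eq lift_inj) eq_sym (negPf (neq_lift _ _)). Qed.

Lemma eq_mid k l : (mid k == mid l) = (k == l).
Proof. by rewrite !(inj_eq lift_inj). Qed.

Lemma neq0_mid k : (ord0 == mid k) = false. Proof. by []. Qed.

Lemma max_neq_mid k : (ord_max == mid k) = false.
Proof. by rewrite eq_sym mid_neq_max. Qed.

Lemma max_neq0 : (ord_max == ord0 :> 'I_d.+2) = false. Proof. by []. Qed.

Lemma neq0_max : (ord0 == ord_max :> 'I_d.+2) = false. Proof. by []. Qed.

Definition midE :=
  (mid_neq0, mid_neq_max, eq_mid, neq0_mid, max_neq_mid, max_neq0, neq0_max, eqxx).

Lemma midP (j : 'I_d.+2) : [\/ j = ord0, j = ord_max | exists k, j = mid k].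
Proof.
case: (unliftP ord0 j) => [i ->|->]; last by constructor 1.
case: (unliftP ord_max i) => [k ->|->]; first by constructor 3; exists k.
by constructor 2; rewrite ord_max_lift.
Qed.

Lemma sum_ord_mid (G : 'I_d.+2 -> R[i]) :
  \sum_j G j = G ord0 + \sum_k G (mid k) + G ord_max.
Proof.
rewrite big_ord_recl big_ord_recr addrA ord_max_lift; congr (_ + _ + _).
by apply: eq_bigr => k _; congr (G (lift _ _)); apply: val_inj; rewrite /= /bump leqNgt ltn_ord.
Qed.

Lemma Phi0 h : Phi h ord0 ord0 = ((cnorm (hvec h) ^+ 2 / 2) +i* hht h)%C.
Proof. by rewrite mxE unlift_none. Qed.

Lemma Phi_mid h k : Phi h ord0 (mid k) = ((ccoord (hvec h) k)^*)%C.
Proof. by rewrite mxE !liftK. Qed.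

Lemma Phi_max h : Phi h ord0 ord_max = 1.
Proof. by rewrite mxE ord_max_lift liftK unlift_none. Qed.

Lemma row_eqP p (z w : 'rV[R[i]]_p) : (forall j, z ord0 j = w ord0 j) -> z = w.
Proof. by move=> zw; apply/rowP. Qed.

Lemma lorentzE x y : lorentz x y = (x ord0 ord0)^*%C * y ord0 ord_max +
  (x ord0 ord_max)^*%C * y ord0 ord0 - \sum_k (x ord0 (mid k))^*%C * y ord0 (mid k).
Proof.
rewrite /lorentz; congr (_ - _); rewrite big_mkcond sum_ord_mid /= add0r ltnn addr0.
by apply: eq_bigr => k _; rewrite /bump [(d <= k)%N]leqNgt !ltn_ord.
Qed.

Lemma lorentzDr x y z : lorentz x (y + z) = lorentz x y + lorentz x z.
Proof.
rewrite !lorentzE !mxE; under eq_bigr do rewrite mxE mulrDr.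
by rewrite big_split/=; ring.
Qed.

Lemma lorentzZr x y (c : R[i]) : lorentz x (c *: y) = c * lorentz x y.
Proof.
rewrite !lorentzE !mxE; under eq_bigr do rewrite mxE mulrCA.
by rewrite -mulr_sumr; ring.
Qed.

Lemma lorentz_mulmx x p (a : 'rV[R[i]]_p) (V : 'M[R[i]]_(p, d.+2)) :
  lorentz x (a *m V) = \sum_i a ord0 i * lorentz x (row i V).
Proof.
have lorentz0 : lorentz x 0 = 0 by rewrite -(scale0r 0) lorentzZr mul0r.
rewrite mulmx_sum_row (big_morph _ (lorentzDr x) lorentz0).
by apply: eq_bigr => i _; rewrite lorentzZr.
Qed.

Variable h : heis R d.
Local Notation x := (Phi h).
Local Notation u := (ccoord (hvec h)).

(** Together with x, these rows form a basis of the orthogonal of x; they are the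
    images of coordinate vectors under the left translation that takes the
    identity to h. *)
Definition dagger_basis : 'M[R[i]]_(d, d.+2) :=
  \matrix_(k, j) ((j == mid k)%:R + (j == ord0)%:R * u k).
Local Notation B := dagger_basis.

(** On the orthogonal of x, the coordinates along the rows of B in the basis
    formed by B and x. *)
Definition dagger_coord : 'M[R[i]]_(d.+2, d) :=
  \matrix_(j, k) ((j == mid k)%:R - (j == ord_max)%:R * (u k)^*%C).
Local Notation P := dagger_coord.

Lemma mul_dagger_coord z k :
  (z *m P) ord0 k = z ord0 (mid k) - z ord0 ord_max * (u k)^*%C.
Proof.
rewrite mxE sum_ord_mid !mxE !midE (bigD1 k)//= !mxE !midE big1 => [|l lk].
  by rewrite /=; ring.
by rewrite !mxE !midE (negPf lk) mul0r subr0 mulr0.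
Qed.

Lemma row_basisE k j : row k B ord0 j = (j == mid k)%:R + (j == ord0)%:R * u k.
Proof. by rewrite !mxE. Qed.

Lemma dagger_basis_coord : B *m P = 1%:M.
Proof.
apply/row_matrixP => k; rewrite row_mul; apply/rowP => l.
rewrite mul_dagger_coord !row_basisE !midE eq_sym.
by rewrite !mxE !mul0r !addr0 mul0r subr0.
Qed.

Lemma Phi_coord : x *m P = 0.
Proof. by apply/rowP => k; rewrite mul_dagger_coord Phi_mid Phi_max mul1r subrr mxE. Qed.

Lemma dagger_decomposition z : dagger x z -> z = z *m P *m B + z ord0 ord_max *: x.
Proof.
rewrite /dagger/= lorentzE Phi_max rmorph1 mul1r => H.
have z0 : z ord0 ord0 = \sum_k u k * z ord0 (mid k) - (x ord0 ord0)^*%C * z ord0 ord_max.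
  apply/eqP; rewrite -subr_eq0; apply/eqP; rewrite -[RHS]H.
  under [in RHS]eq_bigr do rewrite Phi_mid conjcK. ring.
apply: row_eqP => j; rewrite [RHS]mxE [X in _ = X + _]mxE [X in _ = _ + X]mxE.
under eq_bigr do rewrite mul_dagger_coord mxE.
case: (midP j) => [->|->|[k ->]].
- under eq_bigr do rewrite !midE add0r mul1r mulrBl -mulrA conj_mul_normc.
  rewrite sumrB z0 -mulr_sumr -rmorph_sum/= -cnorm_sqrE.
  have -> : ((cnorm (hvec h) ^+ 2)%:C)%C = x ord0 ord0 + (x ord0 ord0)^*%C.
    by rewrite Phi0; apply/eqP; rewrite eq_complex/=; apply/andP; split; apply/eqP; field.
  under [in RHS]eq_bigr do rewrite mulrC.
  by ring.
- under eq_bigr do rewrite !midE mul0r addr0 mulr0.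
  by rewrite big1// add0r Phi_max mulr1.
- rewrite (bigD1 k)//= !midE big1 => [|l lk].
    by rewrite Phi_mid /=; ring.
  by rewrite !midE eq_sym (negPf lk) mul0r addr0 mulr0.
Qed.

End RadialProjection.

Section RadialProjection.
Variables (R : realType) (d : nat).
Local Open Scope ring_scope.
Local Notation vec := 'rV[R[i]]_d.+2.
Local Notation nc := (@Normc.normc R).
Implicit Types (z : vec) (h : heis R d).
Variable h : heis R d.
Local Notation x := (Phi h).
Local Notation u := (ccoord (hvec h)).
Local Notation B := (dagger_basis h).
Local Notation P := (dagger_coord h).

Lemma lorentz_basis h' k :
  lorentz (Phi h') (row k B) = - ccoord (hvec (h^-1 * h')%g) k.
Proof.
rewrite lorentzE !row_basisE Phi_max rmorph1 !midE.
under eq_bigr do rewrite row_basisE !midE mul0r addr0.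
rewrite (bigD1 k)//= big1 => [|l /negPf ->]; last by rewrite mulr0.
rewrite eqxx Phi_mid conjcK ?hvecM ?hvecV ccoordD ccoordN /=; ring.
Qed.

(** Left translations extend to isometries of the form. *)
Lemma lorentz_Phi h' : lorentz (Phi h') x = gaugeC (h^-1 * h')%g.
Proof.
rewrite lorentzE !Phi_max rmorph1 mulr1 mul1r !Phi0.
have -> : \sum_k (Phi h' ord0 (mid k))^*%C * Phi h ord0 (mid k) = cdot (hvec h) (hvec h').
  by apply: eq_bigr => k _; rewrite !Phi_mid conjcK mulrC.
rewrite /gaugeC hvecM hvecV cnormD_sqr cnormN cdotNl /= omegaNl /omega.
case: (cdot _ _) => a b.
by apply/eqP; rewrite eq_complex/=; apply/andP; split; apply/eqP; field.
Qed.

Lemma dagger_row_basis k : dagger x (row k B).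
Proof. by rewrite /dagger/= lorentz_basis mulVg /ccoord mxE oppr0. Qed.

Lemma dagger_Phi : dagger x x.
Proof.
rewrite /dagger/= lorentz_Phi mulVg /gaugeC /=.
have -> : cnorm (0 : cspace R d) = 0.
  by rewrite -(scale0r 0) cnormZ Normc.normc0 mul0r.
by rewrite expr0n/= mul0r oppr0.
Qed.

(** For v the value of the chart at h^-1 * h', a basis of the intersection of the
    orthogonals of the vectors of h and h'. *)
Definition meet_basis (v : cspace R d) : 'M[R[i]]_(d, d.+2) :=
  B + \col_k ccoord v k *m x.

Lemma row_meet_basis v k : row k (meet_basis v) = row k B + ccoord v k *: x.
Proof. by apply/rowP => j; rewrite !mxE big_ord1 !mxE. Qed.

Lemma meet_basis_coord v : meet_basis v *m P = 1%:M.
Proof. by rewrite mulmxDl -mulmxA Phi_coord mulmx0 addr0 dagger_basis_coord. Qed.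

Lemma dagger_meet_basis v k : dagger x (row k (meet_basis v)).
Proof.
rewrite /dagger/= row_meet_basis lorentzDr lorentzZr.
by rewrite (dagger_row_basis k) (dagger_Phi : lorentz x x = 0) mulr0 addr0.
Qed.

Section OtherPoint.
Variable h' : heis R d.
Hypothesis hh' : h' != h.
Let g := (h^-1 * h')%g.

Lemma translate_neq1 : g != 1%g.
Proof. by apply: contra_neq hh' => E; rewrite -[LHS](mulVKg h) -/g E mulg1. Qed.

Lemma ccoord_chart k : ccoord (chart g) k * gaugeC g = ccoord (hvec g) k.
Proof. by rewrite /chart ccoordZ mulrAC mulVf ?mul1r// gaugeC_neq0// translate_neq1. Qed.

Lemma meet_meet_basis k : dagger (Phi h') (row k (meet_basis (chart g))).
Proof.
by rewrite /dagger/= row_meet_basis lorentzDr lorentzZr lorentz_basis lorentz_Phi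
  ccoord_chart addNr.
Qed.

(** If z = sum_k a_k b_k + t x is orthogonal to the vector of h', then
    q t = sum_k a_k u_k, where h^-1 * h' = (u, s): hence t = sum_k a_k F_k. *)
Lemma meet_decomposition z : dagger x z -> dagger (Phi h') z ->
  z = z *m P *m meet_basis (chart g).
Proof.
move=> /dagger_decomposition zE; rewrite /dagger/= {1}zE lorentzDr lorentzZr.
rewrite lorentz_mulmx lorentz_Phi -/g => H.
have zt : z ord0 ord_max = \sum_k (z *m P) ord0 k * ccoord (chart g) k.
  apply: (mulIf (gaugeC_neq0 translate_neq1)); rewrite mulr_suml.
  move/eqP: H; rewrite addrC addr_eq0 => /eqP ->; rewrite -sumrN.
  by apply: eq_bigr => k _; rewrite lorentz_basis -mulrA ccoord_chart; ring.
rewrite {1}zE mulmxDr mulmxA; congr (_ + _).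
apply: row_eqP => j; rewrite mxE zt [RHS]mxE big_ord1; congr (_ * _).
by rewrite [RHS]mxE; apply: eq_bigr => k _; rewrite [X in _ = _ * X]mxE.
Qed.

Lemma row_basis_meet_basis :
  row_basis_of (dagger x `&` dagger (Phi h')) (meet_basis (chart g)).
Proof.
split; first by apply/row_freeP; exists P; exact: meet_basis_coord.
move=> z; split=> [[xz yz]|/submxP[a ->]].
  by rewrite {1}(meet_decomposition xz yz) submxMl.
split; rewrite /dagger/= lorentz_mulmx big1// => k _.
  by rewrite (dagger_meet_basis (chart g) k : lorentz _ _ = 0) mulr0.
by rewrite (meet_meet_basis k : lorentz _ _ = 0) mulr0.
Qed.

Lemma row_basis_vees (V : 'M[R[i]]_(d, d.+2)) : row_basis_of (dagger x `&` dagger (Phi h')) V ->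
  exists2 c : R[i], c != 0 & vees V = c *: vees (meet_basis (chart g)).
Proof.
move=> [Vfree VE]; have VA : V = V *m P *m meet_basis (chart g).
  apply/row_matrixP => k; rewrite !row_mul; apply: meet_decomposition;
  by have /VE[] := row_sub k V.
exists (\det (V *m P)); last by rewrite {1}VA vees_mulmx.
rewrite -unitfE -unitmxE -row_free_unit; apply/eqP/anti_leq.
rewrite rank_leq_row /=; move/eqP: Vfree => {1}<-.
by rewrite {1}VA; exact: mxrankM_maxl.
Qed.

End OtherPoint.

Variable xhat : extalg R d.+2.
Hypothesis xhat_normal : unit_normal x xhat.

Lemma edotDr (v w : extalg R d.+2) : edot xhat (v + w) = edot xhat v + edot xhat w.
Proof. by rewrite -big_split; apply: eq_bigr => J _; rewrite ecoordD mulrDr. Qed.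

Lemma edotZr c (v : extalg R d.+2) : edot xhat (c *: v) = c * edot xhat v.
Proof. by rewrite /edot /hdot mulr_sumr; apply: eq_bigr => J _; rewrite ecoordZ mulrCA. Qed.

Lemma edotC (v w : extalg R d.+2) : edot v w = ((edot w v)^*)%C.
Proof.
rewrite /edot /hdot rmorph_sum/=; apply: eq_bigr => J _.
by rewrite rmorphM/= conjcK mulrC.
Qed.

(** The product of the rows of V differs from det(V P) times that of the rows of
    B by a multivector divisible by x, which is orthogonal to the normal. *)
Lemma edot_vees (V : 'M[R[i]]_(d, d.+2)) : (forall k, dagger x (row k V)) ->
  edot xhat (vees V) = \det (V *m P) * edot xhat (vees B).
Proof.
move=> Vx; have VE : V = V *m P *m B + (\col_k V k ord_max) *m x.
  apply/row_matrixP => k; rewrite linearD/= !row_mul {1}(dagger_decomposition (Vx k)).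
  congr (_ + _); apply: row_eqP => j.
  by rewrite mxE [RHS]mxE big_ord1 !mxE.
have [alpha /(_ (\col_k V k ord_max))] := vees_add_rank1 (V *m P *m B) x.
rewrite -VE vees_mulmx; set G := \sum_i _ => E.
have xG : calA x (vee x G).
  split; last exact: vee_vee.
  exists 2%N, (fun k => if k == ord0 then 1 else - \det (V *m P)),
    (fun k => if k == ord0 then V else B); split.
    by move=> k i; case: ifP => _; [exact: Vx|exact: dagger_row_basis].
  by rewrite big_ord_recl big_ord1 /= scale1r scaleNr E addrC addrA addNr add0r.
have [_ _ /(_ _ xG) nG] := xhat_normal.
by rewrite E edotDr edotZr [edot _ (vee _ _)]edotC nG rmorph0 addr0.
Qed.

(** Otherwise the normal would be orthogonal to every multivector of the
    orthogonal of x, including itself. *)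
Lemma edot_dagger_basis_neq0 : edot xhat (vees B) != 0.
Proof.
have [[m [c [V [Vx xhatE]]]] + _] := xhat_normal.
apply: contra_eqN => /eqP B0; rewrite {2}xhatE.
have edot0 : edot xhat 0 = 0 by rewrite -(scale0r 0) edotZr mul0r.
rewrite (big_morph _ edotDr edot0) big1 ?[0 == 1]eq_sym ?oner_eq0// => k _.
by rewrite edotZr edot_vees// B0 !mulr0.
Qed.

(** The normalization is the same for all the bases that are affine in the chart,
    so that the radial projection itself is affine in the chart. *)
Lemma radial_projE h' : h' != h -> radial_proj h xhat h' =
  (edot xhat (vees B))^-1 *: vees (meet_basis (chart (h^-1 * h')%g)) - xhat.
Proof.
move=> hh'; rewrite /radial_proj.
set V := xget _ _; have /(row_basis_vees hh')[c c0 ->] :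
    row_basis_of (dagger x `&` dagger (Phi h')) V.
  by have := xgetPex (0 : 'M_(d, d.+2)) (ex_intro _ _ (row_basis_meet_basis hh')).
congr (_ - _); rewrite edotZr scalerA invfM mulrAC mulVf// mul1r.
rewrite edot_vees; last exact: dagger_meet_basis.
by rewrite meet_basis_coord det1 mul1r.
Qed.

Lemma vee_Phi_vees_neq0 : vee x (vees B) != 0.
Proof.
(* the columns 1, ..., d + 1, on which x and the rows of B form, up to the order
   of the rows, a unitriangular matrix *)
pose J := [set: 'I_d.+2]%SET :\ ord0.
have maxJ : ord_max \in J by rewrite !inE midE.
suff : ecoord (vee x (vees B)) J != 0.
  by apply: contra_neq => ->; rewrite /ecoord ffunE.
have cardJ j : j \in J -> #|(J :\ j)%SET| = d.
  move=> jJ; have := cardsD1 j J; rewrite jJ /J cardsDS ?finset.subsetT//.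
  by rewrite cardsT card_ord cards1 subn1 /= => -[].
rewrite ecoord_vee (bigD1 ord_max)//= big1 ?addr0 => [|j /andP[jJ jm]]; last first.
  rewrite ecoord_vees cardJ// eqxx.
  have : ord_max \in (J :\ j)%SET by rewrite in_setD1 eq_sym jm maxJ.
  rewrite -mem_enum => /(nthP ord0)[l]; rewrite -cardE cardJ// => ld lE.
  rewrite (expand_det_col _ (Ordinal ld)) big1 ?mulr0// => i _.
  by rewrite !mxE /= lE !midE !mul0r addr0 mul0r.
rewrite Phi_max mulr1 mulf_neq0//.
  by rewrite /vee_sign expf_neq0// oppr_eq0 oner_eq0.
rewrite ecoord_vees cardJ// eqxx.
have enumJ : enum (J :\ ord_max)%SET = [seq mid k | k <- enum 'I_d].
  have tr : transitive (fun i j : 'I_d.+2 => (i < j)%N) by move=> a b c; exact: ltn_trans.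
  apply: (irr_sorted_eq tr) => [a|||j]; first exact: ltnn.
  - exact: sorted_enum.
  - rewrite sorted_map; apply: (sub_sorted (e := fun i j : 'I_d => (i < j)%N)).
      by move=> a b ab; change (mid a < mid b)%N; rewrite !val_mid.
    by have := iota_ltn_sorted 0 d; rewrite -val_enum_ord sorted_map.
  rewrite mem_enum !inE; case: (midP j) => [->|->|[k ->]].
  - rewrite !midE; apply/esym/mapP => -[k _ /eqP]; by rewrite midE.
  - rewrite !midE; apply/esym/mapP => -[k _ /eqP]; by rewrite midE.
  - by rewrite !midE; apply/esym/mapP; exists k; rewrite ?mem_enum.
rewrite (_ : \matrix_(i, j) _ = 1%:M) ?det1 ?oner_eq0//.
apply/matrixP => i j; rewrite !mxE enumJ (nth_map j) ?size_enum_ord// nth_ord_enum.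
by rewrite !midE mul0r addr0 eq_sym.
Qed.

End RadialProjection.

Section RadialBilipschitz.
Variables (R : realType) (d : nat).
Local Open Scope ring_scope.
Local Notation nc := (@Normc.normc R).
Implicit Types v w : cspace R d.
Variable h : heis R d.
Local Notation x := (Phi h).
Local Notation B := (dagger_basis h).
Local Notation N := (fun v => vees (meet_basis h v)).

Lemma vee_Phi_meet v : vee x (N v) = vee x (vees B).
Proof.
have [alpha Halpha] := vees_add_rank1 B x.
by rewrite /= /meet_basis Halpha veeDr vee_vee addr0.
Qed.

(** The product is annihilated by b_k + F_k x: this recovers F_k from it. *)
Lemma vee_row_basis_meet v k : vee (row k B) (N v) = - (ccoord v k *: vee x (vees B)).
Proof.
have := vee_row_vees (meet_basis h v) k.
rewrite row_meet_basis veeDl veeZl vee_Phi_meet => /eqP.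
by rewrite addr_eq0 => /eqP.
Qed.

Lemma meet_product_lower : exists2 C : R, 0 < C &
  forall v w, C * mdist v w <= enorm (N v - N w).
Proof.
have /choice[C HC] : forall k, exists C : R, 0 < C /\
    forall z, enorm (vee (row k B) z) <= C * enorm z.
  by move=> k; have [C C0 HC] := vee_bounded (row k B); exists C.
have n0 : 0 < enorm (vee x (vees B)) by apply/enorm_gt0/vee_Phi_vees_neq0.
pose S := 1 + \sum_k C k.
have S0 : 0 < S by rewrite ltr_pwDl// sumr_ge0// => k _; have [/ltW] := HC k.
exists (enorm (vee x (vees B)) / S); first by rewrite divr_gt0.
move=> v w; rewrite -mulrAC ler_pdivrMr// mulrC.
apply: (@le_trans _ _ (\sum_k nc (ccoord v k - ccoord w k) * enorm (vee x (vees B)))).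
  rewrite -mulr_suml ler_pM2r//; exact: hnorm_le_sum.
rewrite mulrC mulrDl mul1r mulr_suml ler_wpDl ?hnorm_ge0//.
apply: ler_sum => k _; have [_ /(_ (N v - N w))] := HC k; apply: le_trans.
rewrite veeDr veeNr !vee_row_basis_meet opprK [- _ + _]addrC -scalerBl enormZ.
by rewrite -[nc (_ - _)]normcN opprB.
Qed.

Lemma meet_product_upper : exists2 C : R, 0 < C &
  forall v w, enorm (N v - N w) <= C * mdist v w.
Proof.
have [alpha Halpha] := vees_add_rank1 B x.
have [C C0 HC] := vee_bounded x.
pose S := \sum_k enorm (alpha k).
have S0 : 0 <= S by apply: sumr_ge0 => k _; exact: hnorm_ge0.
exists (C * (1 + S)); first by rewrite mulr_gt0// ltr_pwDl.
move=> v w; rewrite /= /meet_basis !Halpha opprD addrACA subrr add0r -veeNr -veeDr.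
apply: le_trans (HC _) _; rewrite -mulrA ler_pM2l// mulrDl mul1r ler_wpDl ?mdist_ge0//.
rewrite -sumrN -big_split/= mulr_suml; apply: le_trans (enorm_sum _) _.
apply: ler_sum => k _; rewrite !mxE -scalerBl enormZ mulrC ler_wpM2l ?hnorm_ge0//.
rewrite [mdist v w]/(hdist _ _).
exact: (@le_hnorm _ _ (fun k => ccoord v k - ccoord w k)).
Qed.

Variable xhat : extalg R d.+2.
Hypothesis xhat_normal : unit_normal x xhat.

(** The radial projection is an injective affine function of the chart. *)
Lemma radial_proj_bilipschitz : exists C1 C2 : R, [/\ 0 < C1, 0 < C2 &
  forall h1 h2, h1 != h -> h2 != h ->
    C1 * mdist (chart (h^-1 * h1)%g) (chart (h^-1 * h2)%g)
      <= mdist (radial_proj h xhat h1) (radial_proj h xhat h2)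
      <= C2 * mdist (chart (h^-1 * h1)%g) (chart (h^-1 * h2)%g)].
Proof.
have [C1 C10 H1] := meet_product_lower; have [C2 C20 H2] := meet_product_upper.
pose s := nc (edot xhat (vees B))^-1.
have s0 : 0 < s by rewrite normc_gt0// invr_eq0 edot_dagger_basis_neq0.
exists (s * C1), (s * C2); split; rewrite ?mulr_gt0// => h1 h2 hh1 hh2.
rewrite !radial_projE// mdist_extE opprB addrA subrK -scalerBr enormZ -/s.
by rewrite -!mulrA !ler_pM2l// H1 H2.
Qed.

End RadialBilipschitz.

(** * Dimensions of the attractors *)

Section HeisenbergSimilarities.
Variables (R : realType) (d : nat).
Local Open Scope ring_scope.
Local Notation nc := (@Normc.normc R).
Implicit Types (u v : cspace R d) (g h : heis R d).

Lemma cdot_unitary (U : 'M[R[i]]_d) u v : U \is unitarymx ->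
  cdot ((u : 'rV_d) *m U^T) ((v : 'rV_d) *m U^T) = cdot u v.
Proof.
move=> /unitarymxP/mulmx1C UU.
have UE i j : \sum_k (U k i)^*%C * U k j = (i == j)%:R.
  move/matrixP/(_ i j): UU; rewrite !mxE => <-.
  by apply: eq_bigr => k _; rewrite !mxE.
rewrite /cdot /hdot /ccoord.
under eq_bigr do rewrite !mxE rmorph_sum/= mulr_suml.
rewrite exchange_big /=; apply: eq_bigr => i _.
under eq_bigr do rewrite mulr_sumr.
rewrite exchange_big /= (bigD1 i)//= [X in _ + X]big1 ?addr0 => [|j ji].
  have E : \sum_k (U k i)^*%C * U k i = 1 by rewrite UE eqxx.
  rewrite -[RHS]mulr1 -E mulr_sumr.
  by apply: eq_bigr => k _; rewrite !mxE rmorphM/=; ring.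
have E : \sum_k (U k i)^*%C * U k j = 0 by rewrite UE eq_sym (negPf ji).
rewrite -[RHS](mulr0 ((ccoord u i)^*%C * ccoord v j)) -[X in _ * X]E mulr_sumr.
by apply: eq_bigr => k _; rewrite !mxE rmorphM/=; rewrite /ccoord; ring.
Qed.

Lemma heis_eqP g h : hvec g = hvec h -> hht g = hht h -> g = h.
Proof. by case: g => u s; case: h => v t /= -> ->. Qed.

Lemma mdist_dilation (r : R) g h : 0 < r ->
  mdist (dilation r g) (dilation r h) = r * mdist g h.
Proof.
move=> r0.
have -> : mdist (dilation r g) (dilation r h) = koranyi_gauge (dilation r (g^-1 * h)%g).
  rewrite mdist_heisE; congr koranyi_gauge; apply: heis_eqP => /=.
    by rewrite scalerDr scalerN.
  rewrite !omegaNl /omega.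
  have -> : cdot ((r%:C)%C *: hvec g) ((r%:C)%C *: hvec h) =
      ((r ^+ 2)%:C)%C * cdot (hvec g) (hvec h).
    rewrite rmorphXn /cdot /hdot mulr_sumr; apply: eq_bigr => k _.
    have -> : (ccoord ((r%:C)%C *: hvec g) k)^*%C = (r%:C)%C * (ccoord (hvec g) k)^*%C.
      by rewrite ccoordZ rmorphM /= oppr0.
    by rewrite ccoordZ; ring.
  by case: (cdot _ _) => a b /=; ring.
apply/eqP; rewrite -(eqrXn2 (n := 2))// ?mulr_ge0 ?koranyi_gauge_ge0 ?mdist_ge0 ?(ltW r0)//.
rewrite mdist_heisE exprMn !koranyi_gauge_sqr mulrCA; apply/eqP; congr (_ * _).
have -> : gaugeC (dilation r (g^-1 * h)%g) = ((r ^+ 2)%:C)%C * gaugeC (g^-1 * h)%g.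
  rewrite /gaugeC /= cnormZ exprMn.
  have -> : nc (r%:C)%C ^+ 2 = r ^+ 2 by rewrite normc_sqr /=; ring.
  by apply/eqP; rewrite eq_complex/=; apply/andP; split; apply/eqP; field.
rewrite Normc.normcM /=; congr (_ * _).
by rewrite expr0n/= addr0 sqrtr_sqr ger0_norm// sqr_ge0.
Qed.

Lemma mdist_rotation (U : 'M[R[i]]_d) g h : U \is unitarymx ->
  mdist (unitary_rotation U g) (unitary_rotation U h) = mdist g h.
Proof.
move=> Uu; rewrite !mdist_heisE; apply/eqP; rewrite -(eqrXn2 (n := 2)) ?koranyi_gauge_ge0//.
rewrite !koranyi_gauge_sqr; apply/eqP; congr (_ * nc _).
have cn w : cnorm ((w : 'rV_d) *m U^T : cspace R d) ^+ 2 = cnorm w ^+ 2.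
  have := cdot_unitary w w Uu; rewrite !cdotxx => /(congr1 (@complex.Re R)); exact.
rewrite /gaugeC /= !omegaNl /omega cdot_unitary//.
have -> : - ((hvec g : 'rV_d) *m U^T) + (hvec h : 'rV_d) *m U^T =
    (- (hvec g : 'rV_d) + (hvec h : 'rV_d)) *m U^T.
  by rewrite mulmxDl mulNmx.
by rewrite cn.
Qed.

(** Rotations preserve the Hermitian product, hence the gauge, and dilations are
    homogeneous; the map below is onto because its linear part is invertible. *)
Lemma lift_similarity (ft : heis R d -> heis R d) (f : cspace R d -> cspace R d) :
  is_lift ft f -> exists r : R, [/\ 0 < r < 1,
    forall g h, mdist (ft g) (ft h) = r * mdist g h,
    forall u v, mdist (f u) (f v) = r * mdist u v,
    forall v, exists u, f u = v &
    forall g, hvec (ft g) = f (hvec g)].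
Proof.
move=> [[a [r [U [r01 Uu ftE]]]] comm]; exists r.
have r0 : 0 < r by case/andP: r01.
have fE u : f u = hvec a + (r%:C)%C *: ((u : 'rV_d) *m U^T : cspace R d).
  have := congr1 (fun F => F (Heis u 0)) comm; rewrite ftE /=.
  by move=> <-.
split => //.
- by move=> g h; rewrite ftE /= mdist_heis_mull mdist_dilation// mdist_rotation.
- move=> u v; rewrite !fE !mdist_cnorm opprD addrACA subrr add0r -scalerBr cnormZ.
  have -> : nc (r%:C)%C = r by rewrite /= expr0n/= addr0 sqrtr_sqr gtr0_norm.
  congr (_ * _); rewrite -[LHS]ger0_norm ?cnorm_ge0// -[RHS]ger0_norm ?cnorm_ge0//.
  rewrite -!sqrtr_sqr; congr Num.sqrt.
  have := cdot_unitary (u - v) (u - v) Uu; rewrite !cdotxx => /(congr1 (@complex.Re R)) /= <-.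
  by rewrite mulmxBl.
- move=> v; have UU : map_mx Num.conj U *m U^T = 1%:M.
    move/unitarymxP/(congr1 trmx): Uu; rewrite trmx_mul trmx1 => <-.
    by congr (_ *m _); apply/matrixP => i j; rewrite !mxE.
  pose w : cspace R d := (r%:C)%C^-1 *: (v - hvec a).
  exists ((w : 'rV_d) *m map_mx Num.conj U); rewrite fE.
  have -> : (w : 'rV_d) *m map_mx Num.conj U *m U^T = w.
    by rewrite -[LHS]mulmxA UU mulmx1.
  have rC0 : (r%:C)%C != 0 :> R[i] by rewrite eq_complex /= gt_eqF.
  apply: cspace_eqP => k; rewrite ccoordD ccoordZ /w ccoordZ ccoordD ccoordN.
  by rewrite mulVKf// addrC subrK.
- by move=> g; have := congr1 (fun F => F g) comm.
Qed.

End HeisenbergSimilarities.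

Section TransverseBounds.
Variables (R : realType) (d : nat).
Local Open Scope ring_scope.
Local Notation nc := (@Normc.normc R).
Variables (h : heis R d) (xhat : extalg R d.+2).
Hypothesis xhat_normal : unit_normal (Phi h) xhat.

(** On an annulus around h the factors 1 / |q| in the increment of the chart are
    bounded above and away from 0. *)
Lemma radial_proj_bounds (delta D : R) : 0 < delta -> exists c L : R, [/\ 0 < c, 0 < L &
  forall h1 h2, delta <= mdist h h1 <= D -> delta <= mdist h h2 <= D ->
    c * mdist (hvec h1) (hvec h2) - L * mdist h1 h2 ^+ 2
      <= mdist (radial_proj h xhat h1) (radial_proj h xhat h2) <= L * mdist h1 h2].
Proof.
move=> d0; have [C1 [C2 [C10 C20 HC]]] := radial_proj_bilipschitz xhat_normal.
have [dD|Dd] := leP delta D; last first.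
  by exists 1, 1; split => // h1 h2 /andP[p q]; have := lt_le_trans Dd (le_trans p q); rewrite ltxx.
have D0 : 0 < D by apply: lt_le_trans dD.
(* with 2 * |q_i| = d(h, h_i)^2, this bounds the coefficient of the error *)
pose K := 2 * D / delta ^+ 4; have K0 : 0 < K by rewrite divr_gt0 ?mulr_gt0 ?exprn_gt0.
pose L := C2 * (2 / delta ^+ 2 + K * (2 * D)) + C1 * K.
exists (C1 * (2 / D ^+ 2)), L; split.
- by rewrite mulr_gt0// divr_gt0// exprn_gt0.
- rewrite /L addr_gt0//; last exact: mulr_gt0.
  rewrite mulr_gt0// addr_gt0//; last by rewrite mulr_gt0 ?K0// mulr_gt0.
  by rewrite divr_gt0// exprn_gt0.
move=> h1 h2 /andP[l1 u1] /andP[l2 u2].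
have neq h' : delta <= mdist h h' -> h' != h.
  by move=> l; rewrite eq_sym -mdist_gt0; apply: lt_le_trans l.
have gneq h' : h' != h -> (h^-1 * h')%g != 1%g.
  by apply: contra_neq => E; rewrite -[LHS](mulVKg h) E mulg1.
have /andP[lo up] := HC h1 h2 (neq _ l1) (neq _ l2).
have := chart_dist (gneq _ (neq _ l1)) (gneq _ (neq _ l2)).
set q1 := nc (gaugeC (h^-1 * h1)%g); set q2 := nc (gaugeC (h^-1 * h2)%g).
have q1E : mdist h h1 ^+ 2 = 2 * q1 by rewrite mdist_heisE koranyi_gauge_sqr.
have q2E : mdist h h2 ^+ 2 = 2 * q2 by rewrite mdist_heisE koranyi_gauge_sqr.
rewrite mdist_heis_mull.
have -> : mdist (hvec (h^-1 * h2)%g) (hvec (h^-1 * h1)%g) = mdist (hvec h1) (hvec h2).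
  by rewrite !mdist_cnorm !hvecM opprD addrACA subrr add0r -cnormN opprB.
rewrite [mdist (chart _) (chart (h^-1 * h1)%g)]metric_sym.
set m := mdist h1 h2; set v := mdist (hvec h1) (hvec h2).
set F := mdist (chart _) _ in lo up *; set G := mdist _ _ in lo up *.
have m0 : 0 <= m by exact: mdist_ge0.
have v0 : 0 <= v by exact: mdist_ge0.
have vm : v <= m by exact: mdist_hvec.
have mD : m <= 2 * D.
  by rewrite (le_trans (metric_triangle h1 h h2))// mulr_natl lerD// metric_sym.
have sq (s : R) : delta <= s -> s <= D -> delta ^+ 2 <= s ^+ 2 <= D ^+ 2.
  move=> ls us; have s0 : 0 <= s by apply: le_trans ls; exact: ltW.
  by rewrite !ler_sqr ?nnegrE ?ls ?us// ltW.
have := sq _ l1 u1; rewrite q1E => /andP[q1l q1u].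
have := sq _ l2 u2; rewrite q2E => /andP[q2l q2u].
have dd0 : 0 < delta ^+ 2 by rewrite exprn_gt0.
have DD0 : 0 < D ^+ 2 by rewrite exprn_gt0.
have q10 : 0 < q1 by lra.
have q20 : 0 < q2 by lra.
have coefK : cnorm (hvec (h^-1 * h1)%g) / (2 * q1 * q2) <= K.
  rewrite /K ler_pdivrMr ?mulr_gt0//.
  apply: (@le_trans _ _ D).
    by apply: le_trans (cnorm_le_gauge _) _; rewrite -mdist_heisE.
  have -> : delta ^+ 4 = delta ^+ 2 * delta ^+ 2 by ring.
  rewrite mulrAC ler_pdivlMr ?mulr_gt0//.
  have -> : 2 * D * (2 * q1 * q2) = D * ((2 * q1) * (2 * q2)) by ring.
  by rewrite ler_pM2l// ler_pM// ltW.
have vup : v / q2 <= v * (2 / delta ^+ 2).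
  by rewrite ler_wpM2l// ler_pdivlMr// mulrC ler_pdivrMr.
have vlo : v * (2 / D ^+ 2) <= v / q2.
  by rewrite ler_wpM2l// ler_pdivrMr// mulrC ler_pdivlMr.
have m2 : 0 <= m ^+ 2 by exact: sqr_ge0.
move=> /ler_normlP[H1 H2].
have mK := ler_wpM2l m2 coefK.
have vmd : v * (2 / delta ^+ 2) <= m * (2 / delta ^+ 2).
  by rewrite ler_wpM2r// divr_ge0// ltW.
have mmD : m ^+ 2 * K <= m * (2 * D) * K.
  by rewrite ler_wpM2r ?(ltW K0)// expr2 ler_wpM2l.
have Flo : v * (2 / D ^+ 2) - m ^+ 2 * K <= F by lra.
have Fup : F <= m * (2 / delta ^+ 2) + m * (2 * D) * K by lra.
apply/andP; split.
  apply: le_trans lo; apply: le_trans (ler_wpM2l (ltW C10) Flo).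
  have S0 : 0 <= 2 / delta ^+ 2 + K * (2 * D).
    by rewrite addr_ge0 ?divr_ge0 ?(ltW dd0)// mulr_ge0 ?(ltW K0)// mulr_ge0// ltW.
  have := mulr_ge0 (mulr_ge0 (ltW C20) S0) m2.
  rewrite /L; lra.
apply: (le_trans up); apply: le_trans (ler_wpM2l (ltW C20) Fup) _.
have := mulr_ge0 (mulr_ge0 (ltW C10) (ltW K0)) m0.
rewrite /L; lra.
Qed.

End TransverseBounds.

Section LiftedIFS.
Variables (R : realType) (d k : nat).
Local Open Scope ring_scope.
Variables (f : 'I_k -> cspace R d -> cspace R d) (ft : 'I_k -> heis R d -> heis R d).
Variables (X : set (cspace R d)) (Xt : set (heis R d)) (r : 'I_k -> R).
Hypothesis r01 : forall i, 0 < r i < 1.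
Hypothesis ft_sim : forall i x y, mdist (ft i x) (ft i y) = r i * mdist x y.
Hypothesis f_sim : forall i x y, mdist (f i x) (f i y) = r i * mdist x y.
Hypothesis f_surj : forall i y, exists x, f i x = y.
Hypothesis hvec_ft : forall i g, hvec (ft i g) = f i (hvec g).
Hypothesis f_osc : open_set_condition f.
Hypothesis X_attr : is_attractor f X.
Hypothesis Xt_attr : is_attractor ft Xt.

Lemma hvec_word w g : hvec (foldr ft g w) = foldr f (hvec g) w.
Proof. by elim: w => //= i w IHw; rewrite hvec_ft IHw. Qed.

(** The cylinders of X with the same address as g accumulate at the projection
    of g. *)
Lemma hvec_attractor g : Xt g -> X (hvec g).
Proof.
move=> Xg; case: (X_attr) => -[x0 Xx0] cX _; case: (Xt_attr) => _ cXt _.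
have : closed X by apply: compact_closed => //; exact: metric_hausdorff.
apply => N /metricType_numDomainType.nbhs_mdistP[e /= e0 eN].
have [D D0 HD] := compact_mdist_bounded cXt.
have [q q01 Hq] := max_ratio r01.
pose M := D + mdist (hvec g) x0 + 1.
have M0 : 0 < M by rewrite ltr_wpDl// addr_ge0 ?mdist_ge0// ltW.
have [n Hn] := exp_lt_eps q01 (divr_gt0 e0 M0).
have [w [g' [wn Xg' gE]]] := attractor_address Xt_attr n Xg.
exists (foldr f x0 w); split; first exact: word_stable.
apply: eN => /=; rewrite {1}gE hvec_word (mdist_word f_sim).
apply: (@le_lt_trans _ _ (q ^+ n * M)); last by rewrite -ltr_pdivlMr.
rewrite ler_pM ?mdist_ge0 ?(ltW (word_ratio_gt0 r01 w))//; first by rewrite -wn Hq.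
apply: (le_trans (metric_triangle _ (hvec g) _)); rewrite /M -addrA lerD//.
  by rewrite (le_trans (mdist_hvec _ _))// HD.
by rewrite lerDl.
Qed.

Section Positive.
Variable t : R.
Hypotheses (t0 : 0 <= t) (Pt : 1 < pressure r t).

(** The separation concerns the horizontal parts, so that it is inherited by
    every map that sees them, and the upper bound on the distances is what makes
    the error of the chart quadratic in rho ^ n. *)
Lemma separated_coding : exists m (p : (nat -> 'I_m) -> heis R d) (c D rho : R),
  [/\ 0 < c, 0 < D, 0 < rho < 1, (2 <= m)%N & 1 <= m%:R * rho `^ t] /\
  [/\ forall a, Xt (p a), forall g h, Xt g -> Xt h -> mdist g h <= D &
    forall a b n, (forall i, (i < n)%N -> a i = b i) -> a n != b n ->
      c * rho ^+ n <= mdist (hvec (p a)) (hvec (p b)) /\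
      mdist (p a) (p b) <= D * rho ^+ n].
Proof.
case: (Xt_attr) => _ cXt _; have [D D0 HD] := compact_mdist_bounded cXt.
have YD x y : (@hvec R d @` Xt) x -> (@hvec R d @` Xt) y -> mdist x y <= D.
  by move=> [g Xg <-] [h Xh <-]; apply: le_trans (mdist_hvec _ _) (HD _ _ Xg Xh).
have [n [W [rho [rho01 W2 Wrho Wsep]]]] :=
  osc_separated_words r01 f_sim f_surj t0 f_osc YD Pt.
have /andP[rho0 rho1] := rho01.
pose word (j : 'I_#|W|) := ffword (enum_val j).
have /choice[p Hp] : forall a : nat -> 'I_#|W|, exists p, Xt p /\
    forall n, exists2 y, Xt y & p = foldr ft y (flatten (mkseq (word \o a) n)).
  by move=> a; have [p] := attractor_coding r01 ft_sim Xt_attr (word \o a); exists p.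
have ratio a N : word_ratio r (flatten (mkseq (word \o a) N)) = rho ^+ N.
  elim: N => [|N IHN]; first by rewrite /word_ratio big_nil.
  rewrite -addn1 /mkseq iotaD map_cat flatten_cat word_ratio_cat IHN /= cats0 addn1 exprSr.
  by rewrite Wrho ?enum_valP.
exists #|W|, p, rho, D, rho; split; last first.
  split=> [a||a b N ab abN]; [by have [] := Hp a|exact: HD|].
  have agree : mkseq (word \o a) N = mkseq (word \o b) N.
    by apply/eq_in_map => i; rewrite mem_iota => /= iN; rewrite ab.
  have [[y Xy pa] [z Xz pb]] := ((Hp a).2 N.+1, (Hp b).2 N.+1).
  move: pa pb; rewrite -addn1 /mkseq !iotaD !map_cat !flatten_cat !foldr_cat /= ?cats0.
  rewrite -/(mkseq (word \o a) N) -/(mkseq (word \o b) N) -agree => -> ->.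
  rewrite !hvec_word (mdist_word f_sim) (mdist_word ft_sim) ratio mulrC.
  rewrite ler_pM2l ?exprn_gt0// [D * _]mulrC ler_pM2l ?exprn_gt0//.
  split; last by rewrite HD//; exact: word_stable.
  apply: Wsep; rewrite ?enum_valP//.
  by apply: contra_neq abN => /enum_val_inj.
split => //; last by apply: le_trans W2; rewrite ler1n.
have rhot : rho `^ t <= 1 by rewrite -[leRHS]/((fun=> 1) t) -powR1 ge0_ler_powR ?nnegrE// ltW.
rewrite -(ler_nat R); apply: le_trans W2 _.
by rewrite ler_piMr// ltW// powR_gt0.
Qed.

Lemma attractors_positive :
  hausdorff_measure t X <> 0%E /\ hausdorff_measure t Xt <> 0%E.
Proof.
have [m [p [c [D [rho [[c0 D0 rho01 m2 mrho] [Xp _ sep]]]]]]] := separated_coding.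
split.
  apply: (separated_coding_hausdorff t0 c0 rho01 m2 mrho (p := @hvec R d \o p)).
    by move=> a; exact: hvec_attractor.
  by move=> a b n ab abn; have [] := sep a b n ab abn.
apply: (separated_coding_hausdorff t0 c0 rho01 m2 mrho Xp) => a b n ab abn.
by have [h _] := sep a b n ab abn; apply: (le_trans h); exact: mdist_hvec.
Qed.

Variables (h : heis R d) (xhat : extalg R d.+2).
Hypothesis xhat_normal : unit_normal (Phi h) xhat.

(** The coding is moved into a small cylinder away from h. *)
Lemma transverse_positive :
  hausdorff_measure t (radial_proj h xhat @` (Xt `\ h)) <> 0%E.
Proof.
have [m [p [c [D [rho [[c0 D0 rho01 m2 mrho] [Xp HD sep]]]]]]] := separated_coding.
have /andP[rho0 rho1] := rho01.
(* two different codes give two points, one of which is not h *)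
have [y Xy yh] : exists2 y, Xt y & y != h.
  pose a : nat -> 'I_m := fun=> Ordinal (ltnW m2); pose b : nat -> 'I_m := fun=> Ordinal m2.
  have [|] := eqVneq (p a) h; last by exists (p a).
  move=> pah; exists (p b) => //; rewrite -pah.
  have [||+ _] := sep a b 0%N; [by []|by []|].
  rewrite expr0 mulr1 => /(lt_le_trans c0); rewrite metric_sym => hab.
  by rewrite -mdist_gt0; apply: lt_le_trans hab _; exact: mdist_hvec.
pose delta := mdist h y / 2.
have hy0 : 0 < mdist h y by rewrite mdist_gt0 eq_sym.
have delta0 : 0 < delta by rewrite divr_gt0.
have [C [L [C0 L0 bounds]]] := radial_proj_bounds xhat_normal (mdist h y + D) delta0.
have [q q01 Hq] := max_ratio r01.
have DD0 : 0 < D ^+ 2 by rewrite exprn_gt0.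
(* the first bound keeps the cylinder of y away from h, the second one makes
   the quadratic error at most half of the main term *)
pose eta := Num.min (delta / D) (C * c / (2 * (L * D ^+ 2))).
have eta0 : 0 < eta by rewrite lt_min !divr_gt0// !mulr_gt0.
have [n Hn] := exp_lt_eps q01 eta0.
have [v [z [vn Xz yE]]] := attractor_address Xt_attr n Xy.
pose s := word_ratio r v.
have s0 : 0 < s by exact: word_ratio_gt0.
have : s < eta by apply: le_lt_trans Hn; rewrite -vn Hq.
rewrite lt_min => /andP[]; rewrite ltr_pdivlMr// => s1.
rewrite ltr_pdivlMr ?mulr_gt0// => s2.
have near g : Xt g -> delta <= mdist h (foldr ft g v) <= mdist h y + D.
  move=> Xg; have gy : mdist (foldr ft g v) y <= s * D.
    by rewrite yE (mdist_word ft_sim) ler_pM2l// HD.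
  have := metric_triangle h (foldr ft g v) y.
  have := metric_triangle h y (foldr ft g v); rewrite [mdist y _]metric_sym.
  have : mdist (foldr ft g v) y <= D by apply: HD => //; exact: word_stable.
  have : mdist h y = delta + delta by rewrite /delta -splitr.
  by move=> *; apply/andP; split; lra.
have cs0 : 0 < C * c * s / 2 by rewrite divr_gt0// !mulr_gt0.
apply: (separated_coding_hausdorff t0 cs0 rho01 m2 mrho
  (p := fun a => radial_proj h xhat (foldr ft (p a) v))).
  move=> a; exists (foldr ft (p a) v) => //; split; first exact: word_stable.
  move=> /= E; have /andP[+ _] := near _ (Xp a).
  by rewrite E mdistxx leNgt delta0.
move=> a b N ab abN; have [lo up] := sep a b N ab abN.
have /andP[+ _] := bounds _ _ (near _ (Xp a)) (near _ (Xp b)); apply: le_trans.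
rewrite !hvec_word (mdist_word f_sim) (mdist_word ft_sim) -/s.
set e := rho ^+ N in lo up *; set A := mdist (hvec _) _ in lo *.
set B := mdist (p a) (p b) in up *.
have e0 : 0 < e by rewrite exprn_gt0.
have e1 : e <= 1 by rewrite exprn_ile1 ?ltW.
have h1 : C * (s * (c * e)) <= C * (s * A) by rewrite !ler_pM2l.
have h2 : L * (s * B) ^+ 2 <= L * (s * (D * e)) ^+ 2.
  rewrite ler_pM2l// ler_sqr ?nnegrE ?mulr_ge0 ?mdist_ge0 ?(ltW s0) ?(ltW D0) ?(ltW e0)//.
  by rewrite ler_pM2l.
have h3 : L * (s * (D * e)) ^+ 2 <= C * c * s / 2 * e.
  have -> : L * (s * (D * e)) ^+ 2 = (s * (2 * (L * D ^+ 2))) * (s * e * e / 2) by field.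
  have -> : C * c * s / 2 * e = C * c * (s * e * 1 / 2) by field.
  apply: ler_pM.
  - by rewrite !mulr_ge0// ltW.
  - by rewrite !mulr_ge0 ?invr_ge0// ltW.
  - exact: (ltW s2).
  - by rewrite ler_pM2r// ler_pM2l// mulr_gt0.
by lra.
Qed.

End Positive.

Section Null.
Variable t : R.
Hypotheses (t0 : 0 <= t) (Pt : pressure r t < 1).
Variables (h : heis R d) (xhat : extalg R d.+2).
Hypothesis xhat_normal : unit_normal (Phi h) xhat.

Lemma transverse_null :
  hausdorff_measure t (radial_proj h xhat @` (Xt `\ h)) = 0%E.
Proof.
have Xt0 := attractor_null r01 ft_sim Xt_attr t0 Pt.
case: (Xt_attr) => -[y Xy] cXt _; have [D D0 HD] := compact_mdist_bounded cXt.
pose A n := Xt `&` [set g | n.+1%:R^-1 <= mdist h g].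
apply: (@hausdorff_null_sub _ _ _ _ (\bigcup_n (radial_proj h xhat @` A n))).
  move=> _ [g [Xg gh] <-]; have hg0 : 0 < mdist h g.
    by rewrite mdist_gt0; apply/eqP => E; apply: gh.
  exists (Num.bound (mdist h g)^-1) => //; exists g => //; split => //=.
  rewrite -[leRHS]invrK lef_pV2 ?posrE ?invr_gt0//.
  have inv0 : 0 <= (mdist h g)^-1 by rewrite invr_ge0 ltW.
  by apply: le_trans (ltW (archi_boundP inv0)) _; rewrite ler_nat.
apply: hausdorff_null_bigcup => n.
have n0 : 0 < n.+1%:R^-1 :> R by rewrite invr_gt0.
have [C [L [_ L0 bounds]]] := radial_proj_bounds xhat_normal (mdist h y + D) n0.
apply: (@hausdorff_null_lipschitz _ _ _ t L) => //; last first.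
  by apply: hausdorff_null_sub Xt0 => g [].
have near g : A n g -> n.+1%:R^-1 <= mdist h g <= mdist h y + D.
  move=> [Xg ->] /=; rewrite (le_trans (metric_triangle h y g))// lerD2l HD//.
by move=> g1 g2 /near n1 /near n2; have /andP[] := bounds g1 g2 n1 n2.
Qed.

End Null.
End LiftedIFS.

Theorem theoremB (R : realType) (d k : nat)
    (f : 'I_k -> cspace R d -> cspace R d)
    (ft : 'I_k -> heis R d -> heis R d)
    (X : set (cspace R d)) (Xt : set (heis R d)) :
  (1 <= d)%N ->
  (forall i, contractive_similarity (f i)) ->
  open_set_condition f ->
  (forall i, is_lift (ft i) (f i)) ->
  is_attractor f X ->
  is_attractor ft Xt ->
  forall (x : heis R d) (xhat : extalg R d.+2),
    unit_normal (Phi x) xhat ->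
    transverse_dim x xhat Xt = hausdorff_dim X /\
    hausdorff_dim X = hausdorff_dim Xt.
Proof.
move=> _ _ osc lifts X_attr Xt_attr x xhat xhatP.
have /choice[r liftP] := fun i => lift_similarity (lifts i).
have r01 i := let: And5 p _ _ _ _ := liftP i in p.
have ft_sim i := let: And5 _ p _ _ _ := liftP i in p.
have f_sim i := let: And5 _ _ p _ _ := liftP i in p.
have f_surj i := let: And5 _ _ _ p _ := liftP i in p.
have hvec_ft i := let: And5 _ _ _ _ p := liftP i in p.
have pos t t0 Pt := attractors_positive r01 ft_sim f_sim f_surj hvec_ft osc X_attr Xt_attr
  (t := t) t0 Pt.
have dX := hausdorff_dim_pressure r01 (attractor_null r01 f_sim X_attr)
  (fun t t0 Pt => (pos t t0 Pt).1).
have dXt := hausdorff_dim_pressure r01 (attractor_null r01 ft_sim Xt_attr)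
  (fun t t0 Pt => (pos t t0 Pt).2).
split; last by rewrite dX dXt.
rewrite dX; apply: (hausdorff_dim_pressure r01) => t t0 Pt.
  exact: (transverse_null r01 ft_sim Xt_attr t0 Pt xhatP).
exact: (transverse_positive r01 ft_sim f_sim f_surj hvec_ft osc Xt_attr t0 Pt xhatP).
Qed.
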